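(* Let $n,m$ be positive integers. The number of non-isomorphic coloured quivers in the $m$-mutation class of a quiver of Dynkin type $A_n$ is $$\sum_{\substack{d\mid n\\ d\mid m+2}}\ \sum_{t=1}^{\min\{\frac{m+2}{d},\frac{n}{d}\}}\left[\frac{\phi(d)\,d\,t}{(m+2)n}\binom{(m+2)/d}{t}\binom{(m+1)\frac{n}{d}}{\frac{n}{d}-t}\right]-\frac{1}{n+1}\binom{(m+1)(n+1)}{n-1}+\frac{1}{n+1}\binom{(m+1)(n+1)/2}{(n+1)/2-1},$$ where the last term is omitted if $2\nmid n+1$.
   Context: $\phi$ denotes Euler's totient function and the outer sum runs over positive integers $d$ dividing both $n$ and $m+2$. Coloured quivers here have finitely many vertices, arrows with colours in $\{0,\dots,m\}$, no loops, all arrows from $i$ to $j$ of the same colour, and if there are $q$ arrows $i\to j$ of colour $c$ then there are $q$ arrows $j\to i$ of colour $m-c$. Isomorphisms of coloured quivers preserve colours. The mutation $\mu_j(Q)$ at a vertex $j$ is obtained as follows: (1) for each pair of arrows $i\to j$ of colour $c$ and $j\to k$ of colour $0$ with $i\neq k$, add an arrow $i\to k$ of colour $c$ and an arrow $k\to i$ of colour $m-c$; (2) if there are arrows of different colours from a vertex $i$ to a vertex $k$, cancel the same number of arrows of each colour until only arrows of one colour from $i$ to $k$ remain; (3) add one to the colour of all arrows going into $j$ and subtract one from the colour of all arrows going out of $j$ (colours modulo $m+1$). The $m$-mutation class of a quiver of Dynkin type $A_n$ is the set of coloured quivers obtained by iterated mutation from the coloured quiver having an arrow $i\to j$ of colour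 $0$ and an arrow $j\to i$ of colour $m$ for each arrow $i\to j$ of the Dynkin quiver (an orientation of the path with $n$ vertices). *)

(* Defs.v *)
From mathcomp Require Import all_boot.
From mathcomp Require Import classical_sets.

Set Implicit Arguments.
Unset Strict Implicit.
Unset Printing Implicit Defensive.

(* [Q i j c] is the number of arrows i -> j of colour c, where the colours
   0, ..., m form ['I_m.+1].  The value of [rev_ord c] is m - c. *)
Record cquiver (m : nat) (V : finType) := CQuiver {
  arrows :> V -> V -> 'I_m.+1 -> nat;
  arrows_noloop : forall i c, arrows i i c = 0;
  arrows_monochrome : forall i j c c',
    0 < arrows i j c -> 0 < arrows i j c' -> c = c';
  arrows_skew : forall i j c, arrows j i (rev_ord c) = arrows i j c
}.

Definition isomorphic (m : nat) (V : finType) (Q Q' : cquiver m V) : Prop :=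
  exists2 f : V -> V, bijective f & forall i j c, Q' (f i) (f j) c = Q i j c.

Definition iso_class (m : nat) (V : finType) (Q : cquiver m V) :
  set (cquiver m V) := [set Q' | isomorphic Q Q']%classic.

Section Mutation.
Variables (m : nat) (V : finType).
Implicit Types (q : V -> V -> 'I_m.+1 -> nat) (i j k : V) (c : 'I_m.+1).

(* The first product counts the arrows i -> k of colour c added for the pairs
   i -> j -> k; the second one counts the arrows i -> k of colour m - (m - c)
   added together with the arrows k -> i of colour m - c, for the pairs
   k -> j -> i. *)
Definition add_composites j q i k c : nat :=
  if i == k then q i k c
  else q i k c + q i j c * q j k ord0 + q k j (rev_ord c) * q j i ord0.

(* Removing one arrow of each colour again and again until a single colour is
   left removes from the most frequent colour as many arrows as there are of
   the second most frequent one. *)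
Definition cancel_colours q i k c : nat :=
  q i k c - \max_(c' | c' != c) q i k c'.

(* An arrow into j that has colour c after the shift had colour c - 1 before,
   an arrow out of j had colour c + 1; [ordS] and [ord_pred] are cyclic. *)
Definition shift_colours j q i k c : nat :=
  if k == j then q i k (ord_pred c)
  else if i == j then q i k (ordS c)
  else q i k c.

Definition mutate_arrows j q : V -> V -> 'I_m.+1 -> nat :=
  shift_colours j (cancel_colours (add_composites j q)).

Variables (j : V) (Q : cquiver m V).

Lemma cancel_colours_monochrome q i k c c' :
  0 < cancel_colours q i k c -> 0 < cancel_colours q i k c' -> c = c'.
Proof.
have lt_max d d' : d != d' -> 0 < cancel_colours q i k d' -> q i k d < q i k d'.
  rewrite subn_gt0 => ne; apply: leq_ltn_trans.
  exact: (@leq_bigmax_cond _ (fun e => e != d') (fun e => q i k e)).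
move=> h h'; apply/eqP/negPn/negP => ne.
have := ltn_trans (lt_max _ _ ne h') (lt_max c' c _ h).
by rewrite ltnn eq_sym => /(_ ne).
Qed.

Lemma mutate_noloop i c : mutate_arrows j Q i i c = 0.
Proof.
have z d : cancel_colours (add_composites j Q) i i d = 0.
  by rewrite /cancel_colours /add_composites eqxx arrows_noloop sub0n.
by rewrite /mutate_arrows /shift_colours !z !if_same.
Qed.

Lemma mutate_monochrome i k c c' :
  0 < mutate_arrows j Q i k c -> 0 < mutate_arrows j Q i k c' -> c = c'.
Proof.
rewrite /mutate_arrows /shift_colours; case: ifP => _.
  by move=> h /(cancel_colours_monochrome h)/(can_inj (@ord_predK _)).
case: ifP => _; last exact: cancel_colours_monochrome.
by move=> h /(cancel_colours_monochrome h)/(can_inj (@ordSK _)).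
Qed.

Lemma add_composites_skew i k c :
  add_composites j Q k i (rev_ord c) = add_composites j Q i k c.
Proof.
by rewrite /add_composites eq_sym arrows_skew rev_ordK; case: ifP => // _; rewrite addnAC.
Qed.

Lemma cancel_colours_skew i k c :
  cancel_colours (add_composites j Q) k i (rev_ord c) =
  cancel_colours (add_composites j Q) i k c.
Proof.
rewrite /cancel_colours add_composites_skew; congr (_ - _).
rewrite (reindex_inj rev_ord_inj) /=; apply: eq_big => [d | d _].
  by rewrite (inj_eq rev_ord_inj).
exact: add_composites_skew.
Qed.

Lemma rev_ordS c : rev_ord (ordS c) = ord_pred (rev_ord c).
Proof.
apply: val_inj => /=; have := ltn_ord c; rewrite ltnS leq_eqVlt.
case/predU1P => [-> | lt_cm].
  by rewrite modnn subn1 subnn add0n /= modn_small.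
rewrite (modn_small (m := c.+1)) // !subSS -(subnSK lt_cm) addSn /= modnDr.
by rewrite modn_small // ltnS leq_subr.
Qed.

Lemma rev_ord_pred c : rev_ord (ord_pred c) = ordS (rev_ord c).
Proof. by apply: (can_inj (@ord_predK m.+1)); rewrite ordSK -rev_ordS ord_predK. Qed.

Lemma mutate_skew i k c :
  mutate_arrows j Q k i (rev_ord c) = mutate_arrows j Q i k c.
Proof.
have [-> | ne_ik] := eqVneq i k; first by rewrite !mutate_noloop.
rewrite /mutate_arrows /shift_colours -rev_ordS -rev_ord_pred.
rewrite !cancel_colours_skew.
by case: (eqVneq i j) ne_ik => [-> | _]; case: (eqVneq k j) => // ->; rewrite eqxx.
Qed.

Definition mutate : cquiver m V :=
  CQuiver mutate_noloop mutate_monochrome mutate_skew.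

End Mutation.

Inductive mutation_class (m : nat) (V : finType) (Q0 : cquiver m V) :
    cquiver m V -> Prop :=
| mutation_class_refl : mutation_class Q0 Q0
| mutation_class_mutate Q j :
    mutation_class Q0 Q -> mutation_class Q0 (mutate j Q).

(* [D i j] means that there is an arrow i -> j.  Booleans are added in [nat]:
   exactly one arrow joins two consecutive vertices, and no other arrow exists. *)
Definition dynkinA (n : nat) (D : rel 'I_n) : Prop :=
  forall i j : 'I_n, D i j + D j i = ((i.+1 == j) || (j.+1 == i)) :> nat.

Section DynkinA.
Variables (m n : nat) (D : rel 'I_n) (hD : dynkinA D).

Definition dynkinA_arrows (i j : 'I_n) (c : 'I_m.+1) : nat :=
  (D i j && (c == ord0)) + (D j i && (c == ord_max)).

Lemma dynkinA_irr i : D i i = false.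
Proof. by move: (hD i i); case: (D i i) => //; case: (_ || _). Qed.

Lemma dynkinA_asym i j : D i j -> D j i = false.
Proof. by move: (hD i j); case: (D i j); case: (D j i) => //; case: (_ || _). Qed.

Lemma dynkinA_noloop i c : dynkinA_arrows i i c = 0.
Proof. by rewrite /dynkinA_arrows dynkinA_irr. Qed.

Lemma dynkinA_monochrome i j c c' :
  0 < dynkinA_arrows i j c -> 0 < dynkinA_arrows i j c' -> c = c'.
Proof.
rewrite /dynkinA_arrows; case: (boolP (D i j)) => [/dynkinA_asym-> | _] /=.
  by rewrite !addn0 !lt0b => /eqP-> /eqP->.
by rewrite !add0n !lt0b => /andP[_ /eqP->] /andP[_ /eqP->].
Qed.

Lemma dynkinA_skew i j c : dynkinA_arrows j i (rev_ord c) = dynkinA_arrows i j c.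
Proof.
have e0 : rev_ord (ord0 : 'I_m.+1) = ord_max.
  by apply: val_inj; rewrite /= subn1.
have eM : rev_ord (ord_max : 'I_m.+1) = ord0 by rewrite -e0 rev_ordK.
rewrite /dynkinA_arrows addnC -{1}eM -{1}e0.
by rewrite !(inj_eq rev_ord_inj).
Qed.

Definition dynkinA_cquiver : cquiver m 'I_n :=
  CQuiver dynkinA_noloop dynkinA_monochrome dynkinA_skew.

End DynkinA.

(* Main.v *)
(* The quivers of the mutation class are those of the dissections of a polygon into n+1
   cells with m+2 sides: the vertices are the n diagonals, and j is joined to i by an
   arrow i -> j of colour c when both are sides of a common cell in which c sides lie
   strictly between i and j.  Mutation at j merges the two cells along j and cuts the
   resulting polygon along the next diagonal.  All dissections are connected by such
   flips (each one is brought to a comb), and a dissection can be read off from its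
   quiver up to rotation, starting from one vertex and its two cliques of neighbours.

   A dissection up to rotation is a plane tree of cells up to re-rooting.  Moving the
   root towards the majority of the cells ends at a centroid, so that the classes are the
   cell-rooted trees (necklaces of m+2 rooted trees, counted by Burnside's lemma) minus
   those with too large a branch, with a correction when an edge halves the tree.  A
   branch and its complement form a pair of rooted trees, and all counts reduce to the
   number M/(M+as) binomial(M+as, s) of forests of M trees with s nodes of arity a = m+1. *)
Require Import Defs.
From HB Require Import structures.
From mathcomp Require Import all_boot all_order all_algebra all_fingroup.
From mathcomp Require Import zify ring.

Set Implicit Arguments.
Unset Strict Implicit.
Unset Printing Implicit Defensive.

(** * Plane trees *)

(** The shape of the formula comes from counting unrooted trees. Look at the pairs formed by the two
    forests on either side of an edge, in order. Let P be the number of all such pairs, E the number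
    of those with equally many nodes on both sides, and S the number of those whose two members are
    equal. A necklace with a branch of at least half the cells is such a pair with the larger part
    in front, which gives (P + E)/2 necklaces to discard; the classes with a halving edge come back
    as balanced pairs up to exchange, (E + S)/2 of them. So E cancels and the number of classes is
    the number of necklaces minus P/2 plus S/2. These are the three terms of the formula: the double
    sum is the Burnside count, with d the order of a rotation of the root cell and phi(d) the number
    of rotations of that order; P/2 is the subtracted binomial; S is nonzero only if the n - 1
    diagonals other than the halving one can be shared out equally, whence the condition on n +
    1. *)

(* A dissection seen from one of its cells is the forest of the trees hanging from the
   sides of that cell: [Leaf] is a boundary edge, [Node v A] the diagonal v followed by
   the other sides, in cyclic order, of the cell behind it. *)
Inductive tree (V : Type) := Leaf | Node of V & seq (tree V).
Arguments Leaf {V}.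

Section ForestInduction.
Variables (V : Type) (P : seq (tree V) -> Prop).
Hypotheses (P0 : P [::]) (PL : forall F, P F -> P (Leaf :: F)).
Hypothesis PN : forall v A F, P A -> P F -> P (Node v A :: F).

Fixpoint tree_forest_ind (t : tree V) : forall F, P F -> P (t :: F) :=
  match t with
  | Leaf => PL
  | Node v A => fun F PF => PN v
      ((fix go (A : seq (tree V)) : P A :=
        if A is u :: A' then tree_forest_ind u (go A') else P0) A) PF
  end.

(** The generated principle for [tree] says nothing about the trees in the list of a [Node].
    Predicates on forests yield hypotheses both for the children and for the trees to the right. *)
Lemma forest_ind F : P F.
Proof. by elim: F => // t F; apply: tree_forest_ind. Qed.
End ForestInduction.

Section TreeCode.
Variable V : Type.
Fixpoint tree_code (t : tree V) : GenTree.tree V :=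
  if t is Node v A then GenTree.Node 1 (GenTree.Leaf v :: map tree_code A)
  else GenTree.Node 0 [::].
Fixpoint tree_decode (c : GenTree.tree V) : tree V :=
  if c is GenTree.Node 1 (GenTree.Leaf v :: A) then Node v (map tree_decode A)
  else Leaf.
Lemma tree_codeK : cancel tree_code tree_decode.
Proof.
move=> t; suff: map tree_decode (map tree_code [:: t]) = [:: t] by case.
move: [:: t]; elim/forest_ind => //= [F -> // | v A F IHA ->].
by rewrite IHA.
Qed.
End TreeCode.

HB.instance Definition _ (V : choiceType) := Choice.copy (tree V) (can_type (@tree_codeK V)).

Section Forests.
Variable V : Type.
Implicit Types (t : tree V) (F G A B : seq (tree V)).

Definition root_label t := if t is Node v _ then Some v else None.

Fixpoint tree_labels t : seq V :=
  if t is Node v A then v :: flatten (map tree_labels A) else [::].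
Definition labels F : seq V := flatten (map tree_labels F).

Fixpoint tree_cells t : seq (seq (option V)) :=
  if t is Node v A then (Some v :: map root_label A) :: flatten (map tree_cells A)
  else [::].
Definition subcells F := flatten (map tree_cells F).
Definition cells F := map root_label F :: subcells F.

Fixpoint tree_wf a t : bool :=
  if t is Node _ A then (size A == a) && all (tree_wf a) A else true.
Definition wf a F := all (tree_wf a) F.

Lemma labels_cat F G : labels (F ++ G) = labels F ++ labels G.
Proof. by rewrite /labels map_cat flatten_cat. Qed.
Lemma labels_node v A F : labels (Node v A :: F) = v :: labels A ++ labels F.
Proof. by []. Qed.
Lemma subcells_cat F G : subcells (F ++ G) = subcells F ++ subcells G.
Proof. by rewrite /subcells map_cat flatten_cat. Qed.
Lemma subcells_node v A F :
  subcells (Node v A :: F) = (Some v :: map root_label A) :: subcells A ++ subcells F.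
Proof. by []. Qed.
Lemma wf_cat a F G : wf a (F ++ G) = wf a F && wf a G.
Proof. exact: all_cat. Qed.
Lemma wf_node a v A F : wf a (Node v A :: F) = [&& size A == a, wf a A & wf a F].
Proof. by rewrite /wf /= andbA. Qed.
Lemma wf_rot a k F : wf a (rot k F) = wf a F.
Proof. by rewrite -{2}(cat_take_drop k F) !wf_cat andbC. Qed.

Definition nodes F := size (labels F).
Lemma nodes_cat F G : nodes (F ++ G) = nodes F + nodes G.
Proof. by rewrite /nodes labels_cat size_cat. Qed.
Lemma nodes_node v A F : nodes (Node v A :: F) = (nodes A + nodes F).+1.
Proof. by rewrite /nodes labels_node /= size_cat. Qed.
Lemma nodes_cons t F : nodes (t :: F) = nodes [:: t] + nodes F.
Proof. by rewrite -nodes_cat. Qed.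
Lemma nodes_rot k F : nodes (rot k F) = nodes F.
Proof. by rewrite -{2}(cat_take_drop k F) !nodes_cat addnC. Qed.
Lemma nodes_leaves k : nodes (nseq k Leaf) = 0.
Proof. by elim: k. Qed.

(* Re-rooting: a cell-rooted forest is a plane tree seen from one of its cells;
   the swap moves the root across the edge [v]. *)
Inductive req a : seq (tree V) -> seq (tree V) -> Prop :=
| req_rot k F : req a F (rot k F)
| req_swap v A B : size A = a -> size B = a -> req a (Node v A :: B) (Node v B :: A)
| req_sym F G : req a F G -> req a G F
| req_trans F G H : req a F G -> req a G H -> req a F H.

Lemma req_refl a F : req a F F.
Proof. by have := req_rot a 0 F; rewrite rot0. Qed.
End Forests.

Section MapForest.
Variables (V W : Type) (f : V -> W).
Fixpoint map_tree (t : tree V) : tree W :=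
  if t is Node v A then Node (f v) (map map_tree A) else Leaf.
Definition map_forest := map map_tree.

Lemma map_forest_node v A F :
  map_forest (Node v A :: F) = Node (f v) (map_forest A) :: map_forest F.
Proof. by []. Qed.
Lemma map_root_label F : map (@root_label W) (map_forest F) = map (omap f) (map (@root_label V) F).
Proof. by rewrite -!map_comp; apply: eq_map => -[]. Qed.
Lemma labels_map F : labels (map_forest F) = map f (labels F).
Proof.
elim/forest_ind: F => // v A F IHA IHF.
by rewrite /map_forest /= !labels_node /= map_cat -IHA -IHF.
Qed.
Lemma nodes_map F : nodes (map_forest F) = nodes F.
Proof. by rewrite /nodes labels_map size_map. Qed.
Lemma subcells_map F : subcells (map_forest F) = map (map (omap f)) (subcells F).
Proof.
elim/forest_ind: F => // v A F IHA IHF.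
by rewrite /map_forest /= !subcells_node /= map_cat -IHA -IHF map_root_label.
Qed.
Lemma cells_map F : cells (map_forest F) = map (map (omap f)) (cells F).
Proof. by rewrite /cells subcells_map map_root_label. Qed.
Lemma wf_map a F : wf a (map_forest F) = wf a F.
Proof.
elim/forest_ind: F => // v A F IHA IHF.
by rewrite map_forest_node !wf_node size_map IHA IHF.
Qed.
Lemma req_map a F G : req a F G -> req a (map_forest F) (map_forest G).
Proof.
elim=> [k H | v A B hA hB | H K _ IH | H K L _ IH1 _ IH2].
- by rewrite /map_forest map_rot; apply: req_rot.
- by apply: req_swap; rewrite size_map.
- exact: req_sym.
- exact: req_trans IH2.
Qed.
End MapForest.

(** A cyclic word with exactly one letter in [p] has a canonical rotation, the one that starts at
    this letter. Hence [occ], and later [front], do not depend on where the word is cut open. *)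
Lemma rot_find T (p : pred T) k s : count p s = 1 ->
  rot (find p (rot k s)) (rot k s) = rot (find p s) s.
Proof.
move=> hp.
have aux u x v : count p (u ++ x :: v) = 1 -> p x ->
    rot (find p (u ++ x :: v)) (u ++ x :: v) = x :: v ++ u.
  move=> + px; rewrite count_cat /= px => h.
  have /negbTE hu : ~~ has p u by rewrite has_count; lia.
  by rewrite find_cat hu /= px addn0 rot_size_cat.
have h : has p s by rewrite has_count hp.
case: (split_find h) hp => x u v px _ hp.
rewrite cat_rcons in hp *.
have sk : size (u ++ x :: v) = (size u + size v).+1 by rewrite size_cat /= addnS.
have [le|lt] := leqP k (size u).
  have -> : rot k (u ++ x :: v) = drop k u ++ x :: v ++ take k u.
    rewrite /rot take_cat drop_cat; case: ltnP => [_|le']; first by rewrite -catA.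
    have -> : k = size u by apply/eqP; rewrite eqn_leq le le'.
    by rewrite drop_size take_size subnn drop0 take0 cats0 /= .
  rewrite aux //; last first.
    move: hp; rewrite -{1}(cat_take_drop k u) !count_cat /= !count_cat; lia.
  by rewrite aux // -catA cat_take_drop.
have -> : rot k (u ++ x :: v) = drop (k - size u).-1 v ++ u ++ x :: take (k - size u).-1 v.
  rewrite /rot take_cat drop_cat; case: ltnP => [|_]; first lia.
  have -> : k - size u = (k - size u).-1.+1 by lia.
  by [].
rewrite catA aux //; last first.
  move: hp; rewrite -{1}(cat_take_drop (k - size u).-1 v) !count_cat /= !count_cat; lia.
by rewrite aux // catA cat_take_drop.
Qed.

(** * Cells and their arrows *)

Section Words.
Variable V : eqType.
Implicit Types (w u : seq (option V)) (W : seq (seq (option V))) (i j k : V) (c : nat).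

(* A cell is the cyclic word of its m.+2 sides, where [None] is a side on the
   boundary of the polygon; [occ w i j c] says that j comes c.+1 steps after i. *)
Definition after w i := behead (rot (index (Some i) w) w).
Definition occ w i j c : bool := (Some i \in w) && (index (Some j) (after w i) == c).
Definition arr W i j c : nat := \sum_(w <- W) occ w i j c.

Lemma arr_cons w W i j c : arr (w :: W) i j c = occ w i j c + arr W i j c.
Proof. by rewrite /arr big_cons. Qed.
Lemma arr_cat W W' i j c : arr (W ++ W') i j c = arr W i j c + arr W' i j c.
Proof. by rewrite /arr big_cat. Qed.
Lemma arr_perm W W' i j c : perm_eq W W' -> arr W i j c = arr W' i j c.
Proof. by move=> h; rewrite /arr; apply: perm_big. Qed.

Lemma mem_split w x : x \in w -> exists u u', w = u ++ x :: u'.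
Proof. by case/splitPr => u u'; exists u, u'. Qed.

Lemma mem_pmap_id w i : (i \in pmap id w) = (Some i \in w).
Proof. by rewrite mem_pmap map_id. Qed.

Lemma count_pmap_id w i : count_mem (Some i) w = count_mem i (pmap id w).
Proof. by elim: w => //= -[v|] w IH /=; rewrite IH. Qed.

Lemma occ_rot r w i j c : uniq (pmap id w) -> occ (rot r w) i j c = occ w i j c.
Proof.
move=> u; rewrite /occ mem_rot; case hi: (Some i \in w) => //=.
rewrite /after rot_find // count_pmap_id count_uniq_mem // mem_pmap_id hi //.
Qed.

Lemma occ_head u j k c : occ (Some j :: u) j k c = (index (Some k) u == c).
Proof. by rewrite /occ mem_head /after /= eqxx rot0. Qed.

Lemma after_split u u' i : Some i \notin u -> after (u ++ Some i :: u') i = u' ++ u.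
Proof. by move=> h; rewrite /after index_pivot // rot_size_cat. Qed.

Lemma occ_last j u i c : i != j -> c < size u -> Some j \notin u -> uniq (pmap id u) ->
  occ (Some j :: u) i j c = (index (Some i) u < size u) && (index (Some i) u + c == (size u).-1).
Proof.
move=> ij cu ju un; rewrite index_mem /occ inE (inj_eq Some_inj) (negbTE ij) /=.
case hi: (Some i \in u) => //=.
case: (mem_split hi) => u1 [u2 eu]; subst u; move: ju un cu {hi}; rewrite mem_cat inE negb_or => /andP[ju1].
rewrite negb_or => /andP[_ ju2]; rewrite pmap_cat uniq_catC /= => /andP[+ _].
rewrite mem_cat negb_or !mem_pmap_id => /andP[_ iu1] cu.
have h : Some i \notin Some j :: u1 by rewrite inE negb_or iu1 (inj_eq Some_inj) ij.
rewrite (after_split u2 h) index_cat (negbTE ju2) /= eqxx addn0 index_pivot //.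
by rewrite size_cat /= addnS /= eqn_add2l eq_sym.
Qed.

(** The cyclic word has [size u + 1] letters: k is reached from i in q - p steps, or in
    [size u + 1 + q - p] steps when the way leads past j, and c is one less than the number of
    steps. *)
Lemma occ_cons j u i k c : i != j -> k != j -> c < size u -> uniq (pmap id u) ->
  let p := index (Some i) u in let q := index (Some k) u in
  occ (Some j :: u) i k c =
  [&& p < size u, q < size u & if p < q then q == (p + c).+1 else size u + q == p + c].
Proof.
move=> ij kj cu un /=; rewrite !index_mem /occ inE (inj_eq Some_inj) (negbTE ij) /=.
case hi: (Some i \in u) => //=.
case: (mem_split hi) => u1 [u2 eu]; subst u; move: un cu {hi}; rewrite pmap_cat uniq_catC /= => /andP[].
rewrite mem_cat negb_or !mem_pmap_id => /andP[iu2 iu1] un cu.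
have h : Some i \notin Some j :: u1 by rewrite inE negb_or iu1 (inj_eq Some_inj) ij.
have jk : (Some j == Some k) = false by rewrite (inj_eq Some_inj) eq_sym (negbTE kj).
rewrite (after_split u2 h) index_cat /= jk.
rewrite index_pivot // mem_cat inE index_cat /= !(inj_eq Some_inj).
rewrite size_cat /= in cu *.
have := size_cat u1 u2; rewrite -(index_mem (Some k) u1) -(index_mem (Some k) u2).
have [-> | ki] := eqVneq k i.
  rewrite !index_mem (negbTE iu1) (negbTE iu2).
  rewrite memNindex //=; move: cu; set s1 := size u1; set s2 := size u2.
  rewrite addn0 ltnn => cu _; lia.
have [k1|k1] := boolP (Some k \in u1); have [k2|k2] := boolP (Some k \in u2).
- move: un; rewrite cat_uniq => /and3P[_ /hasPn/(_ k)+ _].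
  by rewrite !mem_pmap_id k1 /= k2 => /(_ isT).
- move: (k1); rewrite -index_mem => k1'; rewrite (memNindex k2) k1' ltnn ltnNge (ltnW k1') /=.
  move: k1' cu; set s1 := size u1; set s2 := size u2; set p := index _ _ => *; lia.
- move: (k2); rewrite -index_mem => k2' _; rewrite (memNindex k1) k2' ltnn /= -ltn_subLR ?subnn //=.
  move: k2' cu; set s1 := size u1; set s2 := size u2; set p := index _ _ => *; lia.
- rewrite (memNindex k1) (memNindex k2) !ltnn /=.
  move: cu; set s1 := size u1; set s2 := size u2 => *; lia.
Qed.

(** An absent k gets the default index [(size w).-1] in [after w i], which the bound on c
    excludes. *)
Lemma occ_notin w i k c : ~~ ((Some i \in w) && (Some k \in w)) -> c.+1 < size w ->
  occ w i k c = false.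
Proof.
rewrite negb_and /occ => /orP[/negbTE->//|kw] cs; apply/negbTE; rewrite negb_and.
case iw: (Some i \in w) => //=.
have -> : index (Some k) (after w i) = (size w).-1.
  rewrite memNindex /after; first by rewrite size_behead size_rot.
  apply: contra kw => /mem_behead; by rewrite mem_rot.
by apply/eqP; lia.
Qed.

End Words.

Lemma cancel_mono m (V : finType) (q : V -> V -> 'I_m.+1 -> nat) i k :
  (forall c c', 0 < q i k c -> 0 < q i k c' -> c = c') ->
  forall c, cancel_colours q i k c = q i k c.
Proof.
move=> h c; rewrite /cancel_colours.
have [-> //|c0] := posnP (q i k c).
rewrite big1 ?subn0 // => c' /eqP ne; apply/eqP; rewrite -leqn0 leqNgt.
by apply/negP => /h /(_ c0).
Qed.

Lemma cancel_two m (V : finType) (q : V -> V -> 'I_m.+1 -> nat) i k (c1 c2 : nat) :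
  c1 != c2 -> c1 <= m -> c2 <= m ->
  (forall c : 'I_m.+1, q i k c = (c == c1 :> nat) + (c == c2 :> nat)) ->
  forall c, cancel_colours q i k c = 0.
Proof.
move=> ne l1 l2 h c; rewrite /cancel_colours; apply/eqP; rewrite subn_eq0.
have main d1 d2 : d1 != d2 -> d2 <= m -> c = d1 :> nat ->
    (forall c : 'I_m.+1, q i k c = (c == d1 :> nat) + (c == d2 :> nat)) ->
    q i k c <= \max_(c' | c' != c) q i k c'.
  move=> ne' l e h'.
  apply: leq_trans (@leq_bigmax_cond _ _ _ (inord d2) _).
    by rewrite !h' inordK // e eqxx (negbTE ne') eq_sym (negbTE ne') eqxx.
  by rewrite -val_eqE /= inordK // e eq_sym.
have [e|n1] := eqVneq (c : nat) c1; first exact: (main c1 c2).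
have [e|n2] := eqVneq (c : nat) c2.
  by apply: (main c2 c1) => //; [rewrite eq_sym | move=> ?; rewrite addnC].
by rewrite h (negbTE n1) (negbTE n2).
Qed.

(** * Mutation of cells *)

(** The letter x leaves in front and y enters at the end, so all other positions drop by one;
    [(size a).+1] means absence both before and after. *)
Lemma index_rcons_uniq (V : eqType) (x y : option V) a k :
  uniq (pmap id (x :: a)) -> (y = Some k -> Some k \notin a) ->
  index (Some k) (rcons a y) =
  if y == Some k then size a else if index (Some k) (x :: a) == 0 then (size a).+1
  else if index (Some k) (x :: a) == (size a).+1 then (size a).+1
  else (index (Some k) (x :: a)).-1.
Proof.
move=> un hd; have [ey|ny] := eqVneq y (Some k).
  by rewrite -cats1 index_cat (negbTE (hd ey)) ey /= eqxx addn0.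
rewrite -cats1 index_cat /= (negbTE ny) /=.
have [ex|nx] := eqVneq x (Some k).
  have /negbTE-> : Some k \notin a; last by rewrite addn1.
  by move: un; rewrite ex /= => /andP[]; rewrite mem_pmap_id.
rewrite addn1 /=; case: (boolP (Some k \in a)) => h; last by rewrite (memNindex h) eqxx.
by rewrite eqSS ltn_eqF // index_mem.
Qed.

(* Cells are written with j first; positions count the other m.+1 sides, and m.+1
   stands for absence.  [cpos m p q c] says that an arrow of colour c goes from the
   label at position p to the one at position q of the same cell. *)
Definition cpos m (p q c : nat) :=
  [&& p < m.+1, q < m.+1 & (p < q) && (q == (p + c).+1) || (q <= p) && (m.+1 + q == p + c)].

Lemma cposE m p q c :
  [&& p < m.+1, q < m.+1 & if p < q then q == (p + c).+1 else m.+1 + q == p + c] = cpos m p q c.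
Proof. by rewrite /cpos (leqNgt q p); case: (p < q); rewrite /= ?orbF. Qed.

Lemma cancel_monoE m (V : finType) (q : V -> V -> 'I_m.+1 -> nat) i k P :
  (forall c : 'I_m.+1, q i k c = P (c : nat)) ->
  (forall c c', c < m.+1 -> c' < m.+1 -> 0 < P c -> 0 < P c' -> c = c') ->
  forall c, cancel_colours q i k c = P c.
Proof.
move=> e h c; rewrite cancel_mono ?e // => c1 c2; rewrite !e => h1 h2.
by apply: val_inj; exact: h (ltn_ord c1) (ltn_ord c2) h1 h2.
Qed.

Lemma cancel_twoE m (V : finType) (q : V -> V -> 'I_m.+1 -> nat) i k P c1 c2 :
  (forall c : 'I_m.+1, q i k c = P (c : nat)) ->
  c1 != c2 -> c1 <= m -> c2 <= m ->
  (forall c, c < m.+1 -> P c = (c == c1) + (c == c2)) ->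
  forall c, cancel_colours q i k c = 0.
Proof. by move=> e ne l1 l2 h; apply: cancel_two ne l1 l2 _ => c; rewrite e h. Qed.

(* The arrows i -> k after the composition step, in terms of the positions p, p' of i
   and q, q' of k in the two cells along j. *)
Definition addpos m (p q p' q' c : nat) :=
   cpos m p q c + cpos m p' q' c
   + (((p < m.+1) && (p + c == m)) + ((p' < m.+1) && (p' + c == m))) * ((q == 0) + (q' == 0))
   + ((q == c) + (q' == c)) * ((p == 0) + (p' == 0)).

Section Positions.
Variables (m : nat) (V : finType) (Q : cquiver m V) (j : V).
Variables (x y : option V) (a b : seq (option V)) (W : seq (seq (option V))).
Hypothesis sa : size a = m.
Hypothesis sb : size b = m.
Hypothesis un : uniq (j :: pmap id ((x :: a) ++ (y :: b))).
Hypothesis Wj : forall w, w \in W -> Some j \notin w.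
Hypothesis Qarr : forall i k c,
  Q i k c = arr ((Some j :: x :: a) :: (Some j :: y :: b) :: W) i k c.

Local Notation ia i := (index (Some i) (x :: a)).
Local Notation ib i := (index (Some i) (y :: b)).

Hypothesis sW : forall w, w \in W -> size w = m.+2.

Lemma arrW0 i k (c : 'I_m.+1) : (forall w, w \in W -> ~~ ((Some i \in w) && (Some k \in w))) ->
  arr W i k c = 0.
Proof.
move=> h; rewrite /arr big_seq big1 // => w wW; rewrite occ_notin ?h // sW //.
by rewrite ltnS ltn_ord.
Qed.

Lemma un_parts : [/\ uniq (pmap id (x :: a)), uniq (pmap id (y :: b)),
   Some j \notin x :: a, Some j \notin y :: b &
   forall i, (ia i < m.+1) -> (ib i < m.+1) -> False].
Proof.
move: un; rewrite pmap_cat cons_uniq mem_cat negb_or !mem_pmap_id cat_uniq.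
move=> /andP[/andP[-> ->] /and3P[-> h ->]]; split=> // i.
rewrite -[in X in X -> _]sa -[in X in _ -> X -> _]sb.
rewrite -[(size a).+1]/(size (x :: a)) -[(size b).+1]/(size (y :: b)) !index_mem => h1 h2.
by move/hasPn: h => /(_ i); rewrite !mem_pmap_id h1 h2 => /(_ isT).
Qed.

Lemma old_j_out k (c : 'I_m.+1) : Q j k c = (ia k == c) + (ib k == c).
Proof.
rewrite Qarr !arr_cons !occ_head arrW0 ?addn0 // => w /Wj /negbTE->//.
Qed.

Lemma old_j_in i (c : 'I_m.+1) : i != j ->
  Q i j c = ((ia i < m.+1) && (ia i + c == m)) + ((ib i < m.+1) && (ib i + c == m)).
Proof.
move=> ij; have [ua ub ja jb _] := un_parts; have lc := ltn_ord c.
rewrite Qarr !arr_cons !occ_last ?[size (_ :: _)]/= ?sa ?sb // arrW0 ?addn0 //.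
by move=> w /Wj /negbTE->; rewrite andbF.
Qed.

Lemma old_other i k (c : 'I_m.+1) : i != j -> k != j ->
  Q i k c = cpos m (ia i) (ia k) c + cpos m (ib i) (ib k) c + arr W i k c.
Proof.
move=> ij kj; have [ua ub _ _ _] := un_parts; have lc := ltn_ord c.
rewrite Qarr !arr_cons addnA !occ_cons ?[size (_ :: _)]/= ?sa ?sb //.
by rewrite !cposE.
Qed.

(* The position, after the flip, of a label that was at position p in its own cell
   and at position q in the other one. *)
Definition newpos p q :=
  if q == 0 then m else if p == 0 then m.+1 else if p == m.+1 then m.+1 else p.-1.

Lemma new_ia k : index (Some k) (rcons a y) = newpos (ia k) (ib k).
Proof.
have [ua ub ja jb dj] := un_parts.
rewrite (index_rcons_uniq ua); last first.
  move=> e; apply/negP => ka; apply: (dj k); last by rewrite e /= eqxx.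
  by rewrite -sa -[(size a).+1]/(size (x :: a)) index_mem inE ka orbT.
rewrite /newpos sa -[y == Some k]/(y == Some k) /=; case: (y == Some k) => //=.
Qed.

Lemma un_swap : uniq (j :: pmap id ((y :: b) ++ (x :: a))).
Proof. by move: un; rewrite !pmap_cat !cons_uniq !mem_cat orbC uniq_catC. Qed.
End Positions.

Section CellMutation.
Variables (m : nat) (V : finType) (Q : cquiver m V) (j : V).
Variables (x y : option V) (a b : seq (option V)) (W : seq (seq (option V))).
Hypothesis m_gt0 : 0 < m.
Hypothesis sa : size a = m.
Hypothesis sb : size b = m.
Hypothesis un : uniq (j :: pmap id ((x :: a) ++ (y :: b))).
Hypothesis Wj : forall w, w \in W -> Some j \notin w.
Hypothesis Wab : forall w i k, w \in W -> i != k ->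
  Some i \in (x :: a) ++ (y :: b) -> Some k \in (x :: a) ++ (y :: b) ->
  ~~ ((Some i \in w) && (Some k \in w)).
Hypothesis sW : forall w, w \in W -> size w = m.+2.
Hypothesis Qarr : forall i k c,
  Q i k c = arr ((Some j :: x :: a) :: (Some j :: y :: b) :: W) i k c.

Local Notation ia i := (index (Some i) (x :: a)).
Local Notation ib i := (index (Some i) (y :: b)).
(** The diagonal j turns by one step: x and y, which follow j in its two cells, change cells and now
    precede j. *)
Local Notation W' := ((Some j :: rcons a y) :: (Some j :: rcons b x) :: W).

Let new_a k : index (Some k) (rcons a y) = newpos m (ia k) (ib k).
Proof. exact: (new_ia sa sb un). Qed.
Let new_b k : index (Some k) (rcons b x) = newpos m (ib k) (ia k).
Proof. exact: (new_ia sb sa (un_swap un)). Qed.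

Let parts := un_parts sa sb un.
Let uniq_new : [/\ uniq (pmap id (rcons a y)), uniq (pmap id (rcons b x)),
  Some j \notin rcons a y & Some j \notin rcons b x].
Proof.
have : uniq (j :: pmap id (rcons a y) ++ pmap id (rcons b x)).
  rewrite -(perm_uniq (s1 := j :: pmap id ((x :: a) ++ (y :: b)))) ?un //.
  rewrite perm_cons -!cats1 -[x :: a]cat1s -[y :: b]cat1s !pmap_cat.
  by apply/seq.permP => p; rewrite !count_cat; lia.
rewrite cons_uniq mem_cat negb_or !mem_pmap_id cat_uniq.
by move=> /andP[/andP[-> ->] /and3P[-> _ ->]].
Qed.

Lemma new_j_out k (c : 'I_m.+1) :
  arr W' j k c = (newpos m (ia k) (ib k) == c) + (newpos m (ib k) (ia k) == c).
Proof.
rewrite !arr_cons !occ_head new_a new_b (arrW0 sW) ?addn0 // => w /Wj /negbTE->//.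
Qed.

Lemma new_j_in i (c : 'I_m.+1) : i != j ->
  let p := newpos m (ia i) (ib i) in let q := newpos m (ib i) (ia i) in
  arr W' i j c = ((p < m.+1) && (p + c == m)) + ((q < m.+1) && (q + c == m)).
Proof.
move=> ij; have [ua ub ja jb] := uniq_new; have lc := ltn_ord c.
rewrite !arr_cons !occ_last ?size_rcons ?sa ?sb // new_a new_b (arrW0 sW) ?addn0 //.
by move=> w /Wj /negbTE->; rewrite andbF.
Qed.

Lemma new_other i k (c : 'I_m.+1) : i != j -> k != j ->
  arr W' i k c = cpos m (newpos m (ia i) (ib i)) (newpos m (ia k) (ib k)) c
   + cpos m (newpos m (ib i) (ia i)) (newpos m (ib k) (ia k)) c + arr W i k c.
Proof.
move=> ij kj; have [ua ub _ _] := uniq_new; have lc := ltn_ord c.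
rewrite !arr_cons addnA !occ_cons ?size_rcons ?sa ?sb // !new_a !new_b.
by rewrite !cposE.
Qed.

Let ia_le k : ia k <= m.+1.
Proof. by rewrite -sa; exact: index_size. Qed.
Let ib_le k : ib k <= m.+1.
Proof. by rewrite -sb; exact: index_size. Qed.
Let ia_inj i k : ia i = ia k -> ia i < m.+1 -> i = k.
Proof.
rewrite -sa -[(size a).+1]/(size (x :: a)) => e; rewrite index_mem => h.
by apply: Some_inj; rewrite -(nth_index None h) e nth_index // -index_mem -e index_mem.
Qed.
Let ib_inj i k : ib i = ib k -> ib i < m.+1 -> i = k.
Proof.
rewrite -sb -[(size b).+1]/(size (y :: b)) => e; rewrite index_mem => h.
by apply: Some_inj; rewrite -(nth_index None h) e nth_index // -index_mem -e index_mem.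
Qed.

Lemma ord_predE (c : 'I_m.+1) : ord_pred c = (if c == 0 :> nat then m else c.-1) :> nat.
Proof.
have lc := ltn_ord c; case: c lc => -[|c] /= lc _; first by rewrite modn_small.
by rewrite modnDr modn_small // ltnW.
Qed.
Lemma ordSE (c : 'I_m.+1) : ordS c = (if c == m :> nat then 0 else c.+1) :> nat.
Proof.
have lc := ltn_ord c; case: c lc => c /= _ lc; case: eqP => [->|/eqP h]; first by rewrite modnn.
by rewrite modn_small // ltnS ltn_neqAle h.
Qed.

Local Ltac mono_case addE cl cr np0 np0' npS npS' :=
  rewrite (cancel_monoE addE);
  [ rewrite /addpos ?cl ?cr /cpos /= ?np0 ?np0' ?npS // ?npS' ?cl ?cr ?ltnn /=; lia
  | do 2 move=> ?; rewrite /addpos ?cl ?cr /cpos /=; lia ].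
Local Ltac two_case addE cl cr np0 np0' npS npS' c1 c2 :=
  rewrite (cancel_twoE (c1 := c1) (c2 := c2) addE); [ | lia | lia | lia | ];
  [ rewrite ?np0 ?np0' ?npS // ?npS' ?cl ?cr /=; lia
  | move=> ?; rewrite /addpos ?cl ?cr /cpos /=; lia ].

(** An arrow of colour 0 out of j ends at x or y, so composites arise only when i or k is one of the
    two sides that change cells. If the flip brings i and k into a common cell, the composite is the
    new arrow; if they must not share a cell afterwards, it meets an arrow of another colour and
    both cancel. *)
Lemma mutate_arr_neq i k c : i != k -> i != j -> k != j ->
  cancel_colours (add_composites j Q) i k c = arr W' i k c.
Proof.
move=> ik ij kj; rewrite new_other //.
have addE (c' : 'I_m.+1) : add_composites j Q i k c' =
   Q i k c' + Q i j c' * Q j k ord0 + Q j k c' * Q i j ord_max.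
  rewrite /add_composites (negbTE ik) arrows_skew -(arrows_skew Q i j ord_max).
  by have -> : rev_ord (ord_max : 'I_m.+1) = ord0 by apply: val_inj; rewrite /= subnn.
have [_ _ _ _ dj] := parts.
have [iin|iout] := boolP ((ia i < m.+1) || (ib i < m.+1)); last first.
  move: iout; rewrite negb_or -!leqNgt => /andP[ha hb].
  have ea : ia i = m.+1 by have := ia_le i; lia.
  have eb : ib i = m.+1 by have := ib_le i; lia.
  have h0 c' : Q i j c' = 0 by rewrite (old_j_in sa sb un Wj Qarr sW) // ea eb ltnn.
  rewrite cancel_mono => [|c1 c2]; rewrite !addE !h0 !mul0n !muln0 !addn0; last exact: arrows_monochrome.
  by rewrite (old_other sa sb un Qarr) // ea eb /newpos !eqxx /= /cpos !ltnn.
have [kin|kout] := boolP ((ia k < m.+1) || (ib k < m.+1)); last first.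
  move: kout; rewrite negb_or -!leqNgt => /andP[ha hb].
  have ea : ia k = m.+1 by have := ia_le k; lia.
  have eb : ib k = m.+1 by have := ib_le k; lia.
  have h0 c' : Q j k c' = 0.
    by rewrite (old_j_out Wj Qarr sW) ea eb !gtn_eqF // ltn_ord.
  rewrite cancel_mono => [|c1 c2]; rewrite !addE !h0 !mul0n !muln0 !addn0; last exact: arrows_monochrome.
  by rewrite (old_other sa sb un Qarr) // ea eb /newpos !eqxx /= /cpos !ltnn /= !andbF.
have W0 (c' : 'I_m.+1) : arr W i k c' = 0.
  apply: (arrW0 sW) => w wW; apply: Wab => //.
    by rewrite mem_cat -!index_mem [size (x :: a)]/= [size (y :: b)]/= sa sb.
  by rewrite mem_cat -!index_mem [size (x :: a)]/= [size (y :: b)]/= sa sb.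
have {}addE (c' : 'I_m.+1) : add_composites j Q i k c' = addpos m (ia i) (ia k) (ib i) (ib k) c'.
  rewrite addE (old_other sa sb un Qarr) // W0 addn0.
  rewrite !(old_j_in sa sb un Wj Qarr sW) // !(old_j_out Wj Qarr sW) //=.
  have z p : (p < m.+1) && (p + m == m) = (p == 0) by lia.
  by rewrite !z /addpos.
rewrite W0 addn0.
have nia : ia i = ia k -> ia k = m.+1.
  move=> e; apply/eqP; rewrite eqn_leq ia_le leqNgt; apply/negP => h.
  by move/eqP: ik; apply; apply: (ia_inj e); rewrite e.
have nib : ib i = ib k -> ib k = m.+1.
  move=> e; apply/eqP; rewrite eqn_leq ib_le leqNgt; apply/negP => h.
  by move/eqP: ik; apply; apply: (ib_inj e); rewrite e.
move: (dj i) (dj k) (ia_le i) (ia_le k) (ib_le i) (ib_le k) addE iin kin nia nib.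
move: (ia i) (ia k) (ib i) (ib k) => p q p' q' di dk lp lq lp' lq' addE iin kin nia nib.
have np0 : newpos m 0 m.+1 = m.+1 by [].
have npS r : r < m -> newpos m r.+1 m.+1 = r by move=> h; rewrite /newpos /= eqSS ltn_eqF.
have np0' : newpos m m.+1 0 = m by [].
have npS' r : newpos m m.+1 r.+1 = m.+1 by rewrite /newpos eqxx.
have cl r c' : cpos m m.+1 r c' = false by rewrite /cpos ltnn.
have cr r c' : cpos m r m.+1 c' = false by rewrite /cpos ltnn andbF.
have lc := ltn_ord c.
(* Each of i and k lies in exactly one of the two cells; the later case distinctions single out
   position 0, that is x or y. *)
have [[ep lt]|[ep lt]] : (p' = m.+1 /\ p < m.+1) \/ (p = m.+1 /\ p' < m.+1) by lia.
all: have [[eq ltq]|[eq ltq]] : (q' = m.+1 /\ q < m.+1) \/ (q = m.+1 /\ q' < m.+1) by lia.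
all: try subst p'; try subst p; try subst q'; try subst q.
- case: p => [|p] in lp lp' lt di nia nib iin addE *; case: q => [|q] in lq lq' ltq dk nia nib kin addE *.
  + lia.
  (* Here i = x leaves the cell of k: the old arrow has colour q, the composite through j has colour
     q + 1. *)
  + two_case addE cl cr np0 np0' npS npS' q q.+1.
  + two_case addE cl cr np0 np0' npS npS' (m - p) (m - p.+1).
  + mono_case addE cl cr np0 np0' npS npS'.
- case: p => [|p] in lp lp' lt di nia nib iin addE *; case: q' => [|q'] in lq lq' ltq dk nia nib kin addE *.
  (* Here i = x and k = y exchange cells: both arrows are composites, of colours m and 0, which
     differ because 0 < m. *)
  + two_case addE cl cr np0 np0' npS npS' m 0.
  + mono_case addE cl cr np0 np0' npS npS'.
  + mono_case addE cl cr np0 np0' npS npS'.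
  + mono_case addE cl cr np0 np0' npS npS'.
- case: p' => [|p'] in lp lp' lt di nia nib iin addE *; case: q => [|q] in lq lq' ltq dk nia nib kin addE *.
  + two_case addE cl cr np0 np0' npS npS' m 0.
  + mono_case addE cl cr np0 np0' npS npS'.
  + mono_case addE cl cr np0 np0' npS npS'.
  + mono_case addE cl cr np0 np0' npS npS'.
- case: p' => [|p'] in lp lp' lt di nia nib iin addE *; case: q' => [|q'] in lq lq' ltq dk nia nib kin addE *.
  + lia.
  + two_case addE cl cr np0 np0' npS npS' q' q'.+1.
  + two_case addE cl cr np0 np0' npS npS' (m - p') (m - p'.+1).
  + mono_case addE cl cr np0 np0' npS npS'.
Qed.

(** Composites that start or end at j would need a loop at j, so arrows at j only undergo the colour
    shift, which agrees with the turn of the diagonal by one step. *)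
Lemma mutate_arr i k c : mutate j Q i k c = arr W' i k c.
Proof.
have [_ _ ja jb dj] := parts; have lc := ltn_ord c.
have [<-|ik] := eqVneq i k.
  rewrite arrows_noloop.
  have [->|ij] := eqVneq i j.
    rewrite new_j_out (memNindex ja) (memNindex jb) /newpos /= sa sb !eqxx.
    by rewrite gtn_eqF.
  rewrite new_other //.
  have z p : cpos m p p c = false by rewrite /cpos; lia.
  rewrite !z; have := arrows_noloop Q i c.
  by rewrite (old_other sa sb un Qarr) //; lia.
have [kj|kj] := eqVneq k j.
  subst k; rewrite /mutate /= /mutate_arrows /shift_colours eqxx.
  have addE c' : add_composites j Q i j c' = Q i j c'.
    by rewrite /add_composites (negbTE ik) !arrows_noloop muln0 mul0n !addn0.
  rewrite cancel_mono => [|c1 c2]; rewrite !addE; last exact: arrows_monochrome.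
  rewrite new_j_in // (old_j_in sa sb un Wj Qarr sW) // ord_predE /newpos.
  move: (dj i) (ia_le i) (ib_le i).
  move: (ia i) (ib i) => [|p] [|q] d l1 l2 /=; rewrite ?eqSS.
  - by have := d isT isT.
  - case: (c =P 0 :> nat) => ?; case: (q =P m) => ?; lia.
  - case: (c =P 0 :> nat) => ?; case: (p =P m) => ?; lia.
  - case: (c =P 0 :> nat) => ?; case: (p =P m) => ?; case: (q =P m) => ?; lia.
have [ij|ij] := eqVneq i j; last first.
  by rewrite /mutate /= /mutate_arrows /shift_colours (negbTE kj) (negbTE ij) mutate_arr_neq.
subst i; rewrite /mutate /= /mutate_arrows /shift_colours eqxx (negbTE kj).
have addE c' : add_composites j Q j k c' = Q j k c'.
  by rewrite /add_composites (negbTE ik) !arrows_noloop muln0 mul0n !addn0.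
rewrite cancel_mono => [|c1 c2]; rewrite !addE; last exact: arrows_monochrome.
rewrite new_j_out // (old_j_out Wj Qarr sW) // ordSE /newpos.
move: (dj k) (ia_le k) (ib_le k).
move: (ia k) (ib k) => [|p] [|q] d l1 l2 /=; rewrite ?eqSS.
- by have := d isT isT.
- case: (c =P m :> nat) => ?; case: (q =P m) => ?; lia.
- case: (c =P m :> nat) => ?; case: (p =P m) => ?; lia.
- case: (c =P m :> nat) => ?; case: (p =P m) => ?; case: (q =P m) => ?; lia.
Qed.
End CellMutation.

(** * Labels, cells and re-rooting of labelled forests *)

Section LabelledForests.
Variable V : choiceType.
Implicit Types (F G A B X : seq (tree V)) (w : seq (option V)) (i k v : V).

Definition top_labels F := pmap id (map (@root_label V) F).

Lemma top_labels_subseq F : subseq (top_labels F) (labels F).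
Proof.
elim: F => // -[|v A] F IH; first exact: IH.
rewrite labels_node [top_labels _]/= -/(top_labels _) /= eqxx.
exact: subseq_trans IH (suffix_subseq _ _).
Qed.

Lemma top_labels_sub F v : v \in top_labels F -> v \in labels F.
Proof. exact: mem_subseq (top_labels_subseq F) v. Qed.

Lemma mem_subcells F w v : w \in subcells F -> Some v \in w -> v \in labels F.
Proof.
elim/forest_ind: F w => // u A F IHA IHF w.
rewrite subcells_node labels_node inE mem_cat inE mem_cat => /or3P[/eqP->|/IHA h|/IHF h].
- rewrite inE => /orP[/eqP[->]|h]; first by rewrite eqxx.
  by rewrite top_labels_sub ?orbT // /top_labels mem_pmap_id.
- by move=> /h->; rewrite orbT.
- by move=> /h->; rewrite !orbT.
Qed.

Lemma size_subcells a F w : wf a F -> w \in subcells F -> size w = a.+1.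
Proof.
elim/forest_ind: F w => // u A F IHA IHF w.
rewrite wf_node subcells_node => /and3P[/eqP sA wA wF]; rewrite inE mem_cat.
case/or3P=> [/eqP->|h|h]; [by rewrite /= size_map sA|exact: IHA|exact: IHF].
Qed.

(** A cell below the root lies behind a single root side and meets the top labels at most in the
    label of that side. So two sides of the polygon merged by a flip share no further cell, as
    [mutate_arr] requires. *)
Lemma subcells_roots F w i k : uniq (labels F) -> w \in subcells F ->
  i \in top_labels F -> k \in top_labels F -> Some i \in w -> Some k \in w -> i = k.
Proof.
elim/forest_ind: F w => // u A F IHA IHF w.
rewrite labels_node cons_uniq cat_uniq mem_cat negb_or.
case/andP=> /andP[uA uF] /and3P[unA /hasPn dj unF].
rewrite subcells_node /top_labels /= -!/(top_labels _) inE mem_cat => h.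
rewrite !inE => hi hk.
have notA x : (x == u) || (x \in top_labels F) -> x \notin labels A.
  by case/orP=> [/eqP->//|/top_labels_sub]; apply: dj.
case/or3P: h => [/eqP->|h|h].
- have key x : (x == u) || (x \in top_labels F) -> Some x \in Some u :: [seq root_label t | t <- A] -> x = u.
    move=> /notA hx; rewrite inE => /orP[/eqP[]//|]; rewrite -mem_pmap_id -/(top_labels A).
    by move=> /top_labels_sub; rewrite (negbTE hx).
  by move=> /(key _ hi)-> /(key _ hk).
- by move=> /(mem_subcells h); rewrite (negbTE (notA _ hi)).
- move=> iw kw; have iF := mem_subcells h iw; have kF := mem_subcells h kw.
  apply: IHF h _ _ iw kw => //.
    by case/orP: hi => // /eqP e; rewrite e (negbTE uF) in iF.
  by case/orP: hk => // /eqP e; rewrite e (negbTE uF) in kF.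
Qed.

Lemma subcells_perm F G : perm_eq F G -> perm_eq (subcells F) (subcells G).
Proof. by move=> h; apply/perm_flatten/perm_map. Qed.
Lemma labels_perm F G : perm_eq F G -> perm_eq (labels F) (labels G).
Proof. by move=> h; apply/perm_flatten/perm_map. Qed.

Variable a : nat.
Lemma req_labels F G : req a F G -> perm_eq (labels F) (labels G).
Proof.
elim=> [k H|v A B _ _|H K _|H K L _ h1 _ h2].
- by apply: labels_perm; rewrite perm_sym perm_rot.
- by rewrite !labels_node perm_cons perm_catC.
- by rewrite perm_sym.
- exact: perm_trans h1 h2.
Qed.
Lemma req_size F G : req a F G -> size F = size G.
Proof.
elim=> [k H|v A B sA sB|H K _->|H K L _ -> _ ->] //; first by rewrite size_rot.
by rewrite /= sA sB.
Qed.
Lemma req_wf F G : req a F G -> wf a F = wf a G.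
Proof.
elim=> [k H|v A B sA sB|H K _->|H K L _ -> _ ->] //; first by rewrite wf_rot.
by rewrite !wf_node sA sB !eqxx [wf a A && _]andbC.
Qed.
Lemma req_arr F G i k c : req a F G -> uniq (labels F) -> arr (cells F) i k c = arr (cells G) i k c.
Proof.
elim=> [r H|v A B _ _|H K h IH|H K L h1 IH1 h2 IH2] un.
- rewrite /cells !arr_cons map_rot occ_rot; last exact: subseq_uniq (top_labels_subseq H) un.
  by congr (_ + _); apply/arr_perm/subcells_perm; rewrite perm_sym perm_rot.
- rewrite /cells !subcells_node !arr_cons !arr_cat /=; lia.
- by rewrite IH // (perm_uniq (req_labels h)).
- by rewrite IH1 // IH2 // -(perm_uniq (req_labels h1)).
Qed.

(** Walk towards v: cross the root edge u of t, rotate the child that contains v to the front, and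
    continue in this smaller tree. *)
Lemma reroot_tree v t G : size G = a -> wf a (t :: G) -> v \in labels [:: t] ->
  exists A B, [/\ size A = a, size B = a & req a (t :: G) (Node v A :: B)].
Proof.
have [n] := ubnP (nodes [:: t]); elim: n t G => // n IH [|u A] G // lt sG.
rewrite wf_node => /and3P[/eqP sA wA wG].
rewrite labels_node cats0 inE => /orP[/eqP->|vA].
  by exists A, G; split=> //; apply: req_refl.
have [t [A1 [A2 [eA vt]]]] : exists t A1 A2, A = A1 ++ t :: A2 /\ v \in labels [:: t].
  elim: A vA {IH lt sA wA} => // t A IHA.
  rewrite -cat1s labels_cat mem_cat => /orP[h|/IHA[t' [A1 [A2 [-> h]]]]].
    by exists t, [::], A.
  by exists t', (t :: A1), A2.
subst A; move: wA sA lt; rewrite /wf all_cat /= -!/(wf a _) !nodes_node !nodes_cat nodes_cons size_cat /=.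
move=> /and3P[w1 wt w2] sA lt.
have [||||A [B [sA' sB h]]] := IH t (A2 ++ Node u G :: A1) => //.
- by move: lt; rewrite /nodes /=; lia.
- by rewrite size_cat /=; lia.
- by rewrite /wf /= all_cat /= -!/(wf a _) wt w2 sG eqxx wG w1.
exists A, B; split=> //; apply: req_trans h.
apply: req_trans (_ : req a _ (Node u G :: A1 ++ t :: A2)) _.
  by apply: req_swap; rewrite ?size_cat.
rewrite -cat_cons.
have -> : t :: A2 ++ Node u G :: A1 = rot (size (Node u G :: A1)) ((Node u G :: A1) ++ t :: A2).
  by rewrite rot_size_cat.
exact: req_rot.
Qed.

Lemma reroot v F : size F = a.+1 -> wf a F -> v \in labels F ->
  exists A B, [/\ size A = a, size B = a & req a F (Node v A :: B)].
Proof.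
move=> sF wF vF.
have [t [F1 [F2 [eF vt]]]] : exists t A1 A2, F = A1 ++ t :: A2 /\ v \in labels [:: t].
  elim: F vF {sF wF} => // t A IHA.
  rewrite -cat1s labels_cat mem_cat => /orP[h|/IHA[t' [A1 [A2 [-> h]]]]].
    by exists t, [::], A.
  by exists t', (t :: A1), A2.
subst F; have [||A [B [sA sB h]]] := reroot_tree (G := F2 ++ F1) _ _ vt.
- by move: sF; rewrite !size_cat /=; lia.
- by move: wF; rewrite /wf /= !all_cat /= andbCA [all _ F2 && _]andbC.
exists A, B; split=> //; apply: req_trans h.
have -> : t :: F2 ++ F1 = rot (size F1) (F1 ++ t :: F2) by rewrite rot_size_cat.
exact: req_rot.
Qed.
End LabelledForests.

(** * Forests representing a coloured quiver *)

Section Rep.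
Variables (m : nat) (V : finType).

Definition rep (q : V -> V -> 'I_m.+1 -> nat) (F : seq (tree V)) : Prop :=
  [/\ size F = m.+2, wf m.+1 F, uniq (labels F), (forall v, v \in labels F) &
      forall i k c, q i k c = arr (cells F) i k c].

Lemma rep_req q F G : req m.+1 F G -> rep q F -> rep q G.
Proof.
move=> h [sF wF uF cF qF]; split.
- by rewrite -(req_size h).
- by rewrite -(req_wf h).
- by rewrite -(perm_uniq (req_labels h)).
- by move=> v; rewrite -(perm_mem (req_labels h)).
- by move=> i k c; rewrite qF (req_arr _ _ _ h).
Qed.

(** With j as a root edge, its two cells are the root cell and the one behind j; the flip hands the
    first tree of each to the end of the other. *)
Lemma rep_mutate (Q : cquiver m V) j s A t B : 0 < m ->
  rep Q (Node j (s :: A) :: (t :: B)) -> rep (mutate j Q) (Node j (rcons A t) :: rcons B s).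
Proof.
move=> m0 [[sB] wF uF cF qF].
have perm : perm_eq (labels (Node j (rcons A t) :: rcons B s)) (labels (Node j (s :: A) :: (t :: B))).
  rewrite !labels_node perm_cons -!labels_cat; apply: labels_perm.
  by rewrite -!cats1 -[s :: A]cat1s -[t :: B]cat1s; apply/seq.permP => p; rewrite !count_cat; lia.
move: wF uF qF cF perm; rewrite !wf_node -wf_cat => /andP[/eqP[sA] wABB] uF qF cF perm.
move: (uF); rewrite labels_node -labels_cat cons_uniq => /andP[jAB uAB].
split.
- by rewrite /= size_rcons sB.
- rewrite wf_node size_rcons sA eqxx /= -wf_cat.
  have : wf m.+1 (rot 1 ((s :: A) ++ (t :: B))) by rewrite wf_rot.
  by rewrite /= rot1_cons -cats1 -catA /= cat_rcons -cats1.
- by rewrite (perm_uniq perm).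
- by move=> v; rewrite (perm_mem perm).
set x := root_label s; set y := root_label t.
set a := map (@root_label V) A; set b := map (@root_label V) B.
have eX : (x :: a) ++ (y :: b) = map (@root_label V) ((s :: A) ++ (t :: B)) by rewrite map_cat.
move=> i k c; rewrite (@mutate_arr m V Q j x y a b (subcells ((s :: A) ++ (t :: B)))) //.
- rewrite /cells !subcells_node !arr_cons !map_rcons addnCA; congr (_ + (_ + _)).
    by rewrite /= map_rcons.
  rewrite -subcells_cat; apply: arr_perm; apply: subcells_perm.
  by rewrite -!cats1 -[s :: A]cat1s -[t :: B]cat1s; apply/seq.permP => p; rewrite !count_cat; lia.
- by rewrite size_map.
- by rewrite size_map.
- rewrite eX cons_uniq -/(top_labels _) (subseq_uniq (top_labels_subseq _) uAB) andbT.
  by apply: contra jAB => /top_labels_sub.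
- by move=> w /mem_subcells h; apply: contra jAB => /h.
- move=> w i' k' wW ne; rewrite eX -!mem_pmap_id -!/(top_labels _) => hi hk.
  apply/negP => /andP[]; rewrite !mem_pmap_id => iw kw.
  move/eqP: ne; apply; exact: (subcells_roots uAB wW hi hk iw kw).
- by move=> w /(size_subcells wABB).
- move=> i' k' c'; by rewrite qF /cells subcells_node !arr_cons addnCA -subcells_cat /=.
Qed.

Lemma rep_step (Q : cquiver m V) F j : 0 < m -> rep Q F ->
  exists G, rep (mutate j Q) G.
Proof.
move=> m0 rF; have [sF wF _ cF _] := rF.
have [[|s A] [[|t B] [sA sB h]]] := reroot sF wF (cF j) => //.
by eexists; apply: rep_mutate m0 (rep_req h rF).
Qed.
End Rep.

(** * The initial quiver *)

Lemma occ_diag (V : eqType) (w : seq (option V)) i c :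
  uniq (pmap id w) -> c.+1 < size w -> occ w i i c = false.
Proof.
move=> un cw; rewrite /occ; case iw: (Some i \in w) => //=.
case: (mem_split iw) => u [u' e]; subst w.
move: un; rewrite pmap_cat uniq_catC /= mem_cat negb_or !mem_pmap_id.
move=> /andP[/andP[i' iu] _]; rewrite after_split // memNindex.
  by move: cw; rewrite !size_cat /=; lia.
by rewrite mem_cat negb_or i' iu.
Qed.

Lemma subcells_uniq (V : choiceType) (F : seq (tree V)) w : uniq (labels F) -> w \in subcells F ->
  uniq (pmap id w).
Proof.
elim/forest_ind: F => // u A F IHA IHF.
rewrite labels_node cons_uniq cat_uniq mem_cat negb_or.
case/andP=> /andP[uA _] /and3P[unA _ unF].
rewrite subcells_node inE mem_cat => /or3P[/eqP->|h|h]; [|exact: IHA|exact: IHF].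
rewrite [pmap _ _]/= -/(top_labels A) cons_uniq (subseq_uniq (top_labels_subseq A) unA) andbT.
by apply: contra uA => /top_labels_sub.
Qed.

Lemma arr_diag (V : choiceType) (F : seq (tree V)) a i c : uniq (labels F) ->
  wf a F -> size F = a.+1 -> c < a -> arr (cells F) i i c = 0.
Proof.
move=> uF wF sF ca; rewrite /arr big_seq big1 // => w.
rewrite inE => /orP[/eqP->|h].
  by rewrite occ_diag ?size_map ?sF // (subseq_uniq (top_labels_subseq F)).
by rewrite occ_diag ?(size_subcells wF h) // (subcells_uniq uF h).
Qed.

Section Chain.
Variables (m : nat) (V : finType) (D : rel V).

(* The cells of a path: the colour from a vertex to its successor is 0 or m
   according to the orientation of the edge. *)
Fixpoint chain (s : seq V) : tree V :=
  if s is v :: s' then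
    Node v (if (if s' is u :: _ then D v u else true) then chain s' :: nseq m Leaf
            else rcons (nseq m Leaf) (chain s'))
  else Leaf.

Definition link v u : seq (option V) :=
  Some v :: if D v u then Some u :: nseq m None else rcons (nseq m None) (Some u).

(** The orientation of an edge only decides at which end of the cell the next vertex sits; labels,
    arities and the deeper cells do not see it. *)
Lemma perm_chain (b : bool) t : perm_eq
  (if b then t :: nseq m Leaf else rcons (nseq m Leaf) t) (t :: nseq m (@Leaf V)).
Proof. by case: b; rewrite // perm_rcons. Qed.

Lemma labels_leaves k : labels (nseq k (@Leaf V)) = [::].
Proof. by elim: k. Qed.
Lemma subcells_leaves k : subcells (nseq k (@Leaf V)) = [::].
Proof. by elim: k. Qed.
Lemma root_leaves k : map (@root_label V) (nseq k Leaf) = nseq k None.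
Proof. by elim: k => //= k ->. Qed.
Lemma wf_leaves a k : wf a (nseq k (@Leaf V)).
Proof. by elim: k. Qed.

Lemma chain_labels s : perm_eq (labels [:: chain s]) s.
Proof.
elim: s => // v s IH; rewrite [chain _]/= labels_node cats0 perm_cons.
apply: perm_trans (labels_perm (perm_chain _ _)) _.
by rewrite -cat1s labels_cat labels_leaves cats0.
Qed.

Lemma chain_wf s : wf m.+1 [:: chain s].
Proof.
elim: s => // v s IH; rewrite [chain _]/= wf_node.
set b := (if s is _ :: _ then _ else _).
rewrite (perm_size (perm_chain b _)) /= size_nseq eqxx /= andbT.
have -> : wf m.+1 (if b then chain s :: nseq m Leaf else rcons (nseq m Leaf) (chain s)) =
  wf m.+1 (chain s :: nseq m Leaf) by exact: perm_all (perm_chain _ _).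
by rewrite -cat1s wf_cat IH wf_leaves.
Qed.

Lemma arr_chain s i k (c : 'I_m.+1) : i != k ->
  arr (subcells [:: chain s]) i k c = \sum_(x <- zip s (behead s)) occ (link x.1 x.2) i k c.
Proof.
move=> ik; elim: s => [|v s IH]; first by rewrite /arr /= !big_nil.
rewrite [chain _]/= subcells_node cats0 arr_cons.
set b := (if s is _ :: _ then _ else _).
have -> : arr (subcells (if b then chain s :: nseq m Leaf else rcons (nseq m Leaf) (chain s))) i k c
   = arr (subcells [:: chain s]) i k c.
  rewrite (arr_perm _ _ _ (subcells_perm (perm_chain b _))) -cat1s.
  by rewrite subcells_cat subcells_leaves cats0.
rewrite IH {IH} /b {b}; case: s => [|u s] /=.
  rewrite !big_nil addn0 root_leaves; have lc := ltn_ord c.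
  rewrite occ_notin //; last by rewrite /= size_nseq.
  rewrite !inE !(inj_eq Some_inj) /=.
  have -> x : Some x \in nseq m (@None V) = false by elim: (m).
  have -> x : Some x \in nseq m (@None V) = false by elim: (m).
  rewrite !orbF; apply/negP => /andP[/eqP h /eqP h']; by rewrite h h' eqxx in ik.
rewrite big_cons; congr (nat_of_bool (occ _ i k c) + _); rewrite /link.
by case: ifP => _; rewrite /= ?map_rcons root_leaves.
Qed.

(** The m boundary sides all lie on the same way round between v and u, so the two arrows have
    colours 0 and m. *)
Lemma occ_link v u i k (c : 'I_m.+1) : v != u -> i != k ->
  occ (link v u) i k c =
    ((v, u) == (i, k)) * (c == (if D v u then 0 else m) :> nat)
  + ((v, u) == (k, i)) * (c == (if D v u then m else 0) :> nat) :> nat.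
Proof.
move=> vu ik; have lc := ltn_ord c.
pose w := if D v u then Some u :: nseq m None else rcons (nseq m None) (Some u).
have sw : size w = m.+1 by rewrite /w; case: (D v u); rewrite /= ?size_rcons size_nseq.
have nN k0 x : Some x \in nseq k0 (@None V) = false by elim: k0.
have pN k0 : pmap id (nseq k0 (@None V)) = [::] by elim: k0.
have pw : pmap id w = [:: u].
  by rewrite /w; case: (D v u); rewrite /= -?cats1 ?pmap_cat pN.
have iw x : index (Some x) w = if x == u then (if D v u then 0 else m) else m.+1.
  have [->|ne] := eqVneq x u; last first.
    by rewrite memNindex // -mem_pmap_id pw inE.
  rewrite /w; case: (D v u); first by rewrite /= eqxx.
  by rewrite -cats1 index_cat nN /= eqxx addn0 size_nseq.
rewrite /link -/w !xpair_eqE.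
have [iv|iv] := eqVneq v i.
  subst i; rewrite occ_head iw eq_sym.
  rewrite (negbTE ik) /= mul0n addn0 [u == k]eq_sym.
  case: (k == u); first by rewrite mul1n eq_sym.
  by rewrite mul0n ltn_eqF.
have [kv|kv] := eqVneq v k.
  subst k; rewrite occ_last ?sw //; last by rewrite pw.
    rewrite iw [u == i]eq_sym ?eqxx /= mul0n add0n.
    case: (i == u); last by rewrite ltnn mul0n.
    by rewrite mul1n; case: (D v u) => /=; congr nat_of_bool; lia.
  by rewrite -mem_pmap_id pw inE.
rewrite occ_cons ?sw // ?[_ == v]eq_sym //; last by rewrite pw.
rewrite !iw /= mul0n; case: (i =P u) => [ei|_]; last by rewrite ltnn.
have -> : (k == u) = false by rewrite -ei eq_sym (negbTE ik).
by rewrite ltnn /= andbF.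
Qed.
End Chain.

Lemma mem_zip_iota b l x y :
  ((x, y) \in zip (iota b l) (behead (iota b l))) = [&& y == x.+1, b <= x & x.+1 < b + l].
Proof.
elim: l b => [|[|l] IH] b; first by rewrite /= in_nil; lia.
  by rewrite /= in_nil; lia.
rewrite [iota b _]/= [behead _]/= [zip _ _]/= inE IH xpair_eqE; lia.
Qed.

Lemma mem_zip_ord n (i k : 'I_n) :
  ((i, k) \in zip (enum 'I_n) (behead (enum 'I_n))) = (i.+1 == k).
Proof.
pose f (x : 'I_n * 'I_n) := (val x.1, val x.2).
have f_inj : injective f by move=> [x y] [x' y'] [/val_inj-> /val_inj->].
rewrite -(mem_map f_inj).
have -> s t : map f (zip s t) = zip (map val s) (map val t).
  by elim: s t => [|x s IH] [|y t] //=; rewrite IH.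
rewrite -behead_map val_enum_ord mem_zip_iota; have lk := ltn_ord k; rewrite /=. lia.
Qed.

Lemma rep_dynkinA n m (D : rel 'I_n) (hD : dynkinA D) :
  rep (dynkinA_cquiver m hD) (chain m D (enum 'I_n) :: nseq m.+1 Leaf).
Proof.
have pe := chain_labels m D (enum 'I_n).
have le : labels (chain m D (enum 'I_n) :: nseq m.+1 Leaf) = labels [:: chain m D (enum 'I_n)].
  by rewrite -cat1s labels_cat labels_leaves cats0.
have sF : size (chain m D (enum 'I_n) :: nseq m.+1 Leaf) = m.+2 by rewrite /= size_nseq.
have wF : wf m.+1 (chain m D (enum 'I_n) :: nseq m.+1 Leaf).
  by rewrite -cat1s wf_cat chain_wf wf_leaves.
have uF : uniq (labels (chain m D (enum 'I_n) :: nseq m.+1 Leaf)).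
  by rewrite le (perm_uniq pe) enum_uniq.
split=> // [v|]; first by rewrite le (perm_mem pe) mem_enum.
move=> i k c; have lc := ltn_ord c.
set Q := dynkinA_cquiver m hD.
have [<-|ik] := eqVneq i k.
  by rewrite arrows_noloop (arr_diag _ uF wF sF).
rewrite /cells arr_cons -cat1s subcells_cat subcells_leaves cats0 arr_chain //.
(* The root cell carries at most the first vertex of the path and contributes no arrow. *)
rewrite occ_notin ?add0n; last by rewrite size_map size_cat /= size_nseq.
  have ue := enum_uniq 'I_n.
  have uz : uniq (zip (enum 'I_n) (behead (enum 'I_n))).
    apply: (@map_uniq _ _ snd); rewrite -/(unzip2 _) unzip2_zip ?size_behead ?leq_pred //.
    by case: (enum 'I_n) ue => //= x s /andP[].
  have sum1 (p : 'I_n * 'I_n) (f : 'I_n * 'I_n -> nat) :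
      \sum_(x <- zip (enum 'I_n) (behead (enum 'I_n))) (x == p) * f x
      = (p \in zip (enum 'I_n) (behead (enum 'I_n))) * f p.
    elim: (zip _ _) uz => [|x s IH] /=; first by rewrite big_nil.
    case/andP=> xs us; rewrite big_cons IH // inE eq_sym.
    case: (p =P x) => [e|_] /=; last by rewrite mul0n.
    by rewrite e (negbTE xs) mul0n addn0.
  rewrite (eq_big_seq (fun x : 'I_n * 'I_n => (x == (i, k)) * (c == (if D x.1 x.2 then 0 else m) :> nat)
     + (x == (k, i)) * (c == (if D x.1 x.2 then m else 0) :> nat))); last first.
    move=> [v u]; rewrite mem_zip_ord => /eqP vu; apply: occ_link => //.
    by apply/eqP => /= e; move: vu; rewrite e => /eqP; rewrite -[X in _ == X]addn0 -addn1 eqn_add2l.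
  rewrite big_split /= !sum1 !mem_zip_ord /=.
  rewrite /dynkinA_arrows -!val_eqE /=; have := hD i k.
  case Dik: (D i k); case Dki: (D k i) => /=; case: (i.+1 =P k) => //=; case: (k.+1 =P i) => //=; lia.
rewrite map_cat root_leaves !mem_cat.
have nN k0 x : Some x \in nseq k0 (@None 'I_n) = false by elim: k0.
rewrite !nN !orbF; case: (enum 'I_n) => //= v s; rewrite !inE !(inj_eq Some_inj).
by apply/negP => /andP[/eqP h /eqP h']; rewrite h h' eqxx in ik.
Qed.

(** * Connectivity under flips *)

Definition unlabel V (F : seq (tree V)) : seq (tree unit) := map_forest (fun=> tt) F.

(* Flips: the two cells along the edge are merged and cut along another diagonal. *)
Inductive flip_eq a : seq (tree unit) -> seq (tree unit) -> Prop :=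
| flip_rot k F : flip_eq a F (rot k F)
| flip_split k A B A' B' : size A = a -> size B = a -> size A' = a ->
    A' ++ B' = rot k (A ++ B) -> flip_eq a (Node tt A :: B) (Node tt A' :: B')
| flip_sym F G : flip_eq a F G -> flip_eq a G F
| flip_trans F G H : flip_eq a F G -> flip_eq a G H -> flip_eq a F H.

Lemma flip_refl a F : flip_eq a F F.
Proof. by have := flip_rot a 0 F; rewrite rot0. Qed.

Lemma flip_swap a A B : size A = a -> size B = a ->
  flip_eq a (Node tt A :: B) (Node tt B :: A).
Proof. by move=> sA sB; apply: (flip_split (k := size A)); rewrite ?rot_size_cat. Qed.

Section Comb.
Variable m : nat.

Fixpoint comb k : tree unit :=
  if k is k'.+1 then Node tt (comb k' :: nseq m Leaf) else Leaf.

Lemma nodes_drop V k (F : seq (tree V)) : nodes (drop k F) <= nodes F.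
Proof. by rewrite -{2}(cat_take_drop k F) nodes_cat leq_addl. Qed.

Lemma nodes0_leaves V (F : seq (tree V)) : nodes F = 0 -> F = nseq (size F) Leaf.
Proof. by elim: F => // -[|v A] F IH //; move/IH => {1}->. Qed.

Lemma nodes_gt0_split V (F : seq (tree V)) : 0 < nodes F ->
  exists P v A G, F = P ++ Node v A :: G.
Proof.
elim: F => // -[|v A] F IH; last by exists [::], v, A, F.
by move/IH => [P [v [A [G ->]]]]; exists (Leaf :: P), v, A, G.
Qed.

(** Induction on the number of nodes of G, then on the nodes outside its first tree. The untouched
    last tree U is what makes the induction work: seen from a cell further inside, it is the whole
    rest of the dissection. *)
Lemma flip_comb G U : size G = m.+1 -> wf m.+1 G ->
  flip_eq m.+1 (rcons G U) (comb (nodes G) :: rcons (nseq m Leaf) U).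
Proof.
have [n] := ubnP (nodes G); elim: n G U => // n IHn G U lt sG wG.
have [k] := ubnP (nodes (behead G)); elim: k G lt sG wG => // k IHk [//|t G] lt sG wG ltk.
have [/nodes0_leaves eG|/nodes_gt0_split[P [[] [A [G' eG]]]]] := posnP (nodes G).
  (* All nodes lie in the first tree: cross its edge, turn the cell behind it into a comb with
     everything else as last tree, and cross back. *)
  case: sG => sG; rewrite eG sG.
  case: t lt wG {ltk} => [|[] A] lt wG; first by rewrite -cat1s nodes_cat nodes_leaves; apply: flip_refl.
  rewrite nodes_node nodes_leaves addn0.
  move: wG; rewrite wf_node => /and3P[/eqP sA wA _].
  have ltA : nodes A < n by move: lt; rewrite nodes_node; lia.
  set L := rcons (nseq m Leaf) U.
  have sL : size L = m.+1 by rewrite size_rcons size_nseq.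
  apply: flip_trans (flip_swap sA sL) _.
  apply: flip_trans (flip_rot _ 1 _) _; rewrite rot1_cons.
  apply: flip_trans (IHn A (Node tt L) ltA sA wA) _.
  apply: flip_trans (_ : flip_eq _ _ (Node tt L :: comb (nodes A) :: nseq m Leaf)) _.
    by apply: flip_sym; apply: flip_trans (flip_rot _ 1 _) _; rewrite rot1_cons; apply: flip_refl.
  by apply: flip_swap => //=; rewrite size_nseq.
subst G; move: wG; rewrite /wf /= all_cat /= -!/(wf _ _) => /and4P[wt wP /andP[/eqP sA wA] wG'].
move: sG lt ltk; rewrite [behead _]/= /= nodes_cons !nodes_cat nodes_node size_cat /= => sG lt ltk.
(* [Y] lists the sides other than U of the polygon obtained by deleting the edge in front of A.
   Cutting off its first m + 1 sides makes a branch that contains t and P, so fewer nodes stay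
   outside the first tree. *)
pose Y := t :: P ++ A ++ G'.
have sY : size Y = m.+1 + m by rewrite /Y /= !size_cat; lia.
have wY : wf m.+1 Y by rewrite /Y /wf /= !all_cat wt /= -!/(wf _ _) wP wA wG'.
have sTY : size (take m.+1 Y) = m.+1 by rewrite size_takel // sY leq_addr.
have nY : nodes (take m.+1 Y) + nodes (drop m.+1 Y) = nodes Y by rewrite -nodes_cat cat_take_drop.
have eY : nodes Y = nodes [:: t] + (nodes P + (nodes A + nodes G')).
  by rewrite /Y nodes_cons !nodes_cat.
have nD : nodes (drop m.+1 Y) <= nodes A + nodes G'.
  rewrite /Y /= drop_cat; case: ltnP => [|_]; first by lia.
  by rewrite -nodes_cat nodes_drop.
apply: flip_trans (_ : flip_eq _ _ (rcons (Node tt (take m.+1 Y) :: drop m.+1 Y) U)) _.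
  apply: flip_trans (flip_rot _ (size P).+1 _) _.
  have -> : rot (size P).+1 (rcons (t :: P ++ Node tt A :: G') U) =
      Node tt A :: rcons G' U ++ t :: P.
    have -> : rcons (t :: P ++ Node tt A :: G') U = (t :: P) ++ Node tt A :: rcons G' U.
      by rewrite /= rcons_cat.
    by rewrite -[(size P).+1]/(size (t :: P)) rot_size_cat.
  rewrite rcons_cons; apply: (flip_split (k := size (A ++ rcons G' U))) => //.
    by rewrite size_cat size_rcons /=; lia.
  rewrite catA rot_size_cat -cats1 catA cat_take_drop /Y -cats1 /=.
  by rewrite -!catA.
clearbody Y.
have -> : nodes [:: t] + (nodes P + (nodes A + nodes G').+1) = nodes (Node tt (take m.+1 Y) :: drop m.+1 Y).
  by rewrite nodes_node nY eY; lia.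
apply: IHk.
- by rewrite nodes_node nY eY; lia.
- by rewrite /= size_drop sY; lia.
- by rewrite wf_node sTY eqxx -wf_cat cat_take_drop.
- by rewrite /=; lia.
Qed.

(** [flip_comb] never touches the last tree, so it is applied twice: the first pass creates a leaf,
    as 0 < m, and this leaf is rotated into the last place before the second pass, which reaches the
    tree U spared so far. *)
Lemma flip_comb_all F : 0 < m -> size F = m.+2 -> wf m.+1 F ->
  flip_eq m.+1 F (comb (nodes F) :: nseq m.+1 Leaf).
Proof.
move=> m0; case/lastP: F => // G U; rewrite size_rcons => -[sG].
rewrite -cats1 wf_cat nodes_cat cats1 => /andP[wG wU].
apply: flip_trans (flip_comb U sG wG) _.
set K := nodes G; have -> : nseq m (@Leaf unit) = Leaf :: nseq m.-1 Leaf by case: (m) m0.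
set C := comb K.
have -> : C :: rcons (Leaf :: nseq m.-1 Leaf) U = [:: C; Leaf] ++ rcons (nseq m.-1 Leaf) U by [].
apply: flip_trans (flip_rot _ (size [:: C; Leaf]) _) _; rewrite rot_size_cat.
rewrite -cat1s catA cats1.
have wC k : wf m.+1 [:: comb k].
  elim: k => // k IH; rewrite [comb _]/= wf_node -cat1s wf_cat IH wf_leaves.
  by rewrite /= size_nseq eqxx.
have nC k : nodes [:: comb k] = k.
  elim: k => // k IH; rewrite [comb _]/= nodes_node addn0 -cat1s nodes_cat IH.
  by rewrite nodes_leaves addn0.
have := @flip_comb (rcons (nseq m.-1 Leaf) U ++ [:: C]) Leaf.
rewrite -cats1 !nodes_cat nodes_leaves nC add0n addnC.
have -> : rcons (nseq m Leaf) Leaf = nseq m.+1 (@Leaf unit).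
  by elim: (m) => //= k ->.
apply.
- by rewrite !size_cat size_nseq /=; lia.
- by rewrite !wf_cat wf_leaves wU wC.
Qed.
End Comb.

Lemma rot_inv T k (s : seq T) : rot (size s - k) (rot k s) = s.
Proof. by rewrite -[RHS](rotK k) /rotr size_rot. Qed.

(** * Shapes that occur in the mutation class *)

Section Class.
Variables (m : nat) (V : finType) (Q0 : cquiver m V).
Hypothesis m_gt0 : 0 < m.

Definition realized (s : seq (tree unit)) : Prop :=
  exists Q F, [/\ mutation_class Q0 Q, rep Q F & unlabel F = s].

Lemma unlabel_node_inv (F : seq (tree V)) A B : unlabel F = Node tt A :: B ->
  exists v A' B', [/\ F = Node v A' :: B', unlabel A' = A & unlabel B' = B].
Proof. by case: F => // -[|v A'] B' // [<- <-]; exists v, A', B'. Qed.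

Lemma size_unlabel T (F : seq (tree T)) : size (unlabel F) = size F.
Proof. exact: size_map. Qed.

Lemma realized_rot k s : realized s -> realized (rot k s).
Proof.
case=> Q [F [cQ rF <-]]; exists Q, (rot k F); split=> //.
  exact: rep_req (req_rot _ _ _) rF.
by rewrite /unlabel /map_forest map_rot.
Qed.

Lemma mutate_iter k v Q A B : mutation_class Q0 Q -> rep Q (Node v A :: B) ->
  k <= size (A ++ B) -> exists Q' A' B',
  [/\ mutation_class Q0 Q', rep Q' (Node v A' :: B') & A' ++ B' = rot k (A ++ B)].
Proof.
move=> cQ rQ; elim: k => [|k IH] lek; first by exists Q, A, B; rewrite rot0.
have [Q' [A' [B' [cQ' rQ' e]]]] := IH (ltnW lek).
have [[sB] + _ _ _] := rQ'; rewrite wf_node => /andP[/eqP sA _].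
case: A' B' sA sB rQ' e => // s A' [|t B'] // _ _ rQ' e.
exists (mutate v Q'), (rcons A' t), (rcons B' s); split.
- exact: mutation_class_mutate.
- exact: rep_mutate.
- by rewrite rotS // -e /= rot1_cons -!cats1 -!catA.
Qed.

Lemma realized_split k A B A' B' : size A = m.+1 -> size B = m.+1 -> size A' = m.+1 ->
  A' ++ B' = rot k (A ++ B) -> realized (Node tt A :: B) -> realized (Node tt A' :: B').
Proof.
move=> sA sB sA' e [Q [F [cQ rF]]] /unlabel_node_inv[v [A1 [B1 [eF eA eB]]]]; subst F.
wlog lek : k e / k <= size (A ++ B).
  move=> W; have [/W|/ltnW gtk] := leqP k (size (A ++ B)); first exact.
  by apply: (W 0) => //; rewrite rot0 e rot_oversize.
have [|Q' [A2 [B2 [cQ' rQ' e2]]]] := mutate_iter (k := k) cQ rF.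
  by move: lek; rewrite -eA -eB !size_cat !size_unlabel.
exists Q', (Node v A2 :: B2); split=> //.
have {}e : unlabel A2 ++ unlabel B2 = A' ++ B'.
  by rewrite e -eA -eB /unlabel /map_forest -!map_cat e2 map_rot.
have sA2 : size (unlabel A2) = size A'.
  by rewrite size_unlabel sA'; have [_ + _ _ _] := rQ'; rewrite wf_node => /andP[/eqP].
move/eqP: e; rewrite eqseq_cat // => /andP[/eqP eA' /eqP eB'].
by rewrite -eA' -eB'.
Qed.

(** The mutation class is generated by mutations in one direction only; a flip is undone by turning
    the same diagonal the rest of the way round the merged polygon. *)
Lemma realized_flip s s' : flip_eq m.+1 s s' -> (realized s <-> realized s').
Proof.
elim=> [k F|k A B A' B' sA sB sA' e|F G _ IH|F G H _ IH1 _ IH2].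
- split; first exact: realized_rot.
  by move/(realized_rot (size F - k)); rewrite rot_inv.
- split; first exact: realized_split e.
  have eAB : A ++ B = rot (size (A ++ B) - k) (A' ++ B').
    by rewrite e rot_inv.
  apply: realized_split eAB => //.
  have := congr1 size e; rewrite size_rot !size_cat; lia.
- by split=> /IH.
- by rewrite IH1.
Qed.

Lemma rep_nodes (q : V -> V -> 'I_m.+1 -> nat) F : rep q F -> nodes F = #|V|.
Proof.
case=> _ _ uF cF _; rewrite /nodes -(card_uniqP uF).
by apply: eq_card => v; rewrite cF.
Qed.

Lemma class_rep : (exists F, rep Q0 F) ->
  forall Q, mutation_class Q0 Q -> exists F, rep Q F.
Proof.
by move=> h Q; elim=> // {}Q j _ [F /(rep_step j m_gt0)].
Qed.

(** The given shape and that of [Q0] flip to the same comb, since both have [#|V|] nodes. *)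
Lemma all_realized : (exists F, rep Q0 F) ->
  forall s, size s = m.+2 -> wf m.+1 s -> nodes s = #|V| -> realized s.
Proof.
case=> F rF s ss ws ns; have [sF wF _ _ _] := rF.
apply/(realized_flip (flip_comb_all m_gt0 ss ws)); rewrite ns -(rep_nodes rF).
rewrite -[nodes F](nodes_map (fun=> tt)).
apply/(realized_flip (flip_comb_all m_gt0 (F := unlabel F) _ _)).
- by rewrite size_unlabel.
- by rewrite wf_map.
- by exists Q0, F; split=> //; apply: mutation_class_refl.
Qed.
End Class.

(** * A forest is determined by its quiver up to re-rooting *)

Lemma index_eq_nth (V : eqType) (u : seq (option V)) y c :
  uniq (pmap id u) -> (nth None u c == Some y) = (c < size u) && (index (Some y) u == c).
Proof.
elim: u c => [|x u IH] [|c] //= un.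
  by case: (x =P Some y).
rewrite IH; last by case: x un => //= x /andP[].
case: (x =P Some y) un => [->|_] /=; last by rewrite ltnS eqSS.
rewrite mem_pmap_id => /andP[yu _]; rewrite ltnS andbF.
by rewrite memNindex // eq_sym; case: ltngtP.
Qed.

Lemma eq_words (V : eqType) (u u' : seq (option V)) : size u = size u' ->
  (forall y c, c < size u -> (nth None u c == Some y) = (nth None u' c == Some y)) -> u = u'.
Proof.
move=> su h; apply: (eq_from_nth (x0 := None)) => // c lc.
case e: (nth None u c) => [y|]; first by have := h y c lc; rewrite e eqxx => /esym/eqP.
case e': (nth None u' c) => [y|] //.
by have := h y c lc; rewrite e' e eqxx.
Qed.

Lemma cyclic_gap m p r : p < m.+1 -> r < m.+1 -> p != r ->
  exists2 c, c < m.+1 & if p < r then r == (p + c).+1 else m.+1 + r == p + c.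
Proof.
move=> lp lr ne; exists (if p < r then r - p.+1 else m.+1 + r - p); case: (ltnP p r) => h; lia.
Qed.

Section Determination.
Variables (m : nat) (V : finType) (q : V -> V -> 'I_m.+1 -> nat).

(* Away from the labels [S] of the parent cell, the neighbours of a label of [F]
   are those of its own cell, so a forest can be read off from the arrows. *)
Inductive fits : seq V -> seq (tree V) -> Prop :=
| fits_nil S : fits S [::]
| fits_leaf S F : fits S F -> fits S (Leaf :: F)
| fits_node S x A F : size A = m.+1 ->
    (forall y, y \in S -> y \notin top_labels A) ->
    (forall y (c : 'I_m.+1), y \notin S ->
      q x y c = (nth None (map (@root_label V) A) c == Some y)) ->
    fits (x :: top_labels A) A -> fits S F -> fits S (Node x A :: F).

Lemma fits_inv S F : fits S F ->
  match F with
  | [::] => True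
  | Leaf :: F => fits S F
  | Node x A :: F => [/\ size A = m.+1,
    (forall y, y \in S -> y \notin top_labels A),
    (forall y (c : 'I_m.+1), y \notin S ->
      q x y c = (nth None (map (@root_label V) A) c == Some y)),
    fits (x :: top_labels A) A & fits S F]
  end.
Proof. by case. Qed.

Lemma mem_top_nth A (c : nat) y :
  nth None (map (@root_label V) A) c == Some y -> y \in top_labels A.
Proof.
move=> /eqP e; rewrite /top_labels mem_pmap_id -e mem_nth // ltnNge.
by apply/negP => h; move: e; rewrite nth_default.
Qed.

Lemma fits_det S F F' : map (@root_label V) F = map (@root_label V) F' ->
  fits S F -> fits S F' -> F = F'.
Proof.
move=> + h; elim: h F' => {S F} [S|S F _ IH|S x A F sA dA qA _ IHA _ IHF] [|[|x' A'] F'] //=.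
  by move=> [e] /fits_inv h; rewrite (IH F').
move=> [e1 e2] /fits_inv; subst x' => -[sA' dA' qA' fA' fF'].
(* A label of S occurs in neither word, and the positions of all others are dictated by [q]. *)
have e : map (@root_label V) A = map (@root_label V) A'.
  apply: eq_words => [|y c]; rewrite !size_map sA // => lc.
  have [yS|yS] := boolP (y \in S).
    apply/idP/idP => /mem_top_nth; first by rewrite (negbTE (dA y yS)).
    by rewrite (negbTE (dA' y yS)).
  by have := qA y (Ordinal lc) yS; rewrite (qA' y (Ordinal lc) yS) /=; do 2 case: (_ == _).
congr (Node x _ :: _); last exact: IHF.
by apply: IHA; rewrite // /top_labels e.
Qed.

Lemma arr_notin (W : seq (seq (option V))) (i k : V) (c : 'I_m.+1) : (forall w, w \in W -> size w = m.+2) ->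
  (forall w, w \in W -> Some i \in w -> Some k \in w -> False) -> arr W i k c = 0.
Proof.
move=> sW h; rewrite (arrW0 sW) // => w wW; apply/negP => /andP[]; exact: h.
Qed.

(** [W] collects the cells outside F, so that the induction can enter a subtree: an outer cell meets
    F only in top labels, and then all its labels lie in S. Arrows from a top label to a vertex
    outside S therefore come from the cell behind that label. *)
Lemma fits_cells F S (W : seq (seq (option V))) : uniq (labels F) -> wf m.+1 F ->
  (forall w, w \in W -> size w = m.+2) ->
  (forall w z, w \in W -> z \in labels F -> Some z \in w ->
     z \in top_labels F /\ forall y, Some y \in w -> y \in S) ->
  (forall y, y \in S -> y \in labels F -> y \in top_labels F) ->
  (forall i k c, q i k c = arr (W ++ subcells F) i k c) -> fits S F.
Proof.
elim/forest_ind: F S W => [|F IH|x A F IHA IHF] S W.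
- by move=> *; constructor.
- by move=> uF wF sW hW hS qW; apply: fits_leaf; apply: IH qW.
rewrite labels_node cons_uniq cat_uniq mem_cat negb_or => /andP[/andP[xA xF]].
case/and3P=> uA /hasPn dj uF; rewrite wf_node => /and3P[/eqP sA wA wF] sW hW hS qW.
have AF z : z \in labels A -> z \notin labels F by move=> zA; apply/negP => /dj; rewrite zA.
have notop z : z \in labels A -> z \notin top_labels (Node x A :: F).
  move=> zA; rewrite inE negb_or; apply/andP; split.
    by apply: contraNneq xA => <-.
  by apply: contra (AF z zA) => /top_labels_sub.
set w0 := Some x :: map (@root_label V) A.
have uw : uniq (pmap id (map (@root_label V) A)) := subseq_uniq (top_labels_subseq A) uA.
have sw0 : size w0 = m.+2 by rewrite /= size_map sA.
have inw0 y : Some y \in w0 -> y \in x :: top_labels A.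
  by rewrite !inE /top_labels mem_pmap_id.
apply: fits_node => //.
- move=> y yS; apply/negP => yA; have yA' := top_labels_sub yA.
  by have := hS y yS; rewrite ?labels_node inE mem_cat yA' orbT (negbTE (notop y yA')) => /(_ isT).
- move=> y c yS; rewrite qW arr_cat subcells_node arr_cons arr_cat occ_head.
  rewrite index_eq_nth // size_map sA ltn_ord /=.
  rewrite !arr_notin ?addn0 //.
  + by move=> w /(size_subcells wF).
  + by move=> w /mem_subcells h /h xF'; rewrite xF' in xF.
  + by move=> w /(size_subcells wA).
  + by move=> w /mem_subcells h /h xA'; rewrite xA' in xA.
  + move=> w wW xw yw; have [|_ h] := hW w x wW _ xw; first by rewrite ?labels_node mem_head.
    by rewrite (h y yw) in yS.
- apply: (IHA _ (w0 :: W ++ subcells F)) => //.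
  + move=> w; rewrite inE mem_cat => /or3P[/eqP->//|/sW//|/(size_subcells wF)//].
  + move=> w z; rewrite inE mem_cat => /or3P[/eqP-> zA zw|wW zA zw|wF' zA zw].
    * split; last by move=> y; apply: inw0.
      by have := inw0 z zw; rewrite inE => /orP[/eqP e|//]; rewrite e (negbTE xA) in zA.
    * have [|h _] := hW w z wW _ zw; first by rewrite ?labels_node inE mem_cat zA orbT.
      by rewrite (negbTE (notop z zA)) in h.
    * by have := mem_subcells wF' zw; rewrite (negbTE (AF z zA)).
  + by move=> y; rewrite inE => /orP[/eqP->|//]; rewrite (negbTE xA).
  + move=> i k c; rewrite qW; apply: arr_perm; apply/seq.permP => p.
    by rewrite subcells_node -/w0 /= !count_cat /= !count_cat; lia.
- apply: (IHF _ (W ++ w0 :: subcells A)) => //.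
  + move=> w; rewrite mem_cat inE => /or3P[/sW//|/eqP->//|/(size_subcells wA)//].
  + move=> w z; rewrite mem_cat inE => /or3P[wW zF zw|/eqP-> zF zw|wA' zF zw].
    * have [|h h'] := hW w z wW _ zw; first by rewrite ?labels_node inE mem_cat zF !orbT.
      split=> //; move: h; rewrite inE => /orP[/eqP e|//].
      by rewrite e (negbTE xF) in zF.
    * have := inw0 z zw; rewrite inE => /orP[/eqP e|/top_labels_sub zA].
        by rewrite e (negbTE xF) in zF.
      by rewrite (negbTE (AF z zA)) in zF.
    * by have zA := mem_subcells wA' zw; rewrite (negbTE (AF z zA)) in zF.
  + move=> y yS yF; have := hS y yS; rewrite ?labels_node inE mem_cat yF !orbT => /(_ isT).
    by rewrite inE => /orP[/eqP e|//]; rewrite e (negbTE xF) in yF.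
  + move=> i k c; rewrite qW; apply: arr_perm; apply/seq.permP => p.
    by rewrite subcells_node -/w0 /= !count_cat /= !count_cat; lia.
Qed.

Section Root.
Variables (j : V) (A B : seq (tree V)).
Hypothesis rAB : rep q (Node j A :: B).

Lemma rep_parts : [/\ size A = m.+1, size B = m.+1, wf m.+1 A, wf m.+1 B & uniq (j :: labels A ++ labels B)].
Proof.
have [[sB] + uF _ _] := rAB; rewrite wf_node => /and3P[/eqP sA wA wB]; split=> //.
Qed.

Lemma rep_swap : rep q (Node j B :: A).
Proof. by have [sA sB _ _ _] := rep_parts; apply: rep_req rAB; apply: req_swap. Qed.

Lemma fits_rep : fits (j :: top_labels A) A.
Proof.
have [sA sB wA wB] := rep_parts; rewrite cons_uniq cat_uniq mem_cat negb_or.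
case/andP=> /andP[jA jB] /and3P[uA /hasPn dj uB]; have [_ _ _ _ qF] := rAB.
pose wA0 := Some j :: map (@root_label V) A; pose wB0 := Some j :: map (@root_label V) B.
apply: (@fits_cells _ _ (wB0 :: wA0 :: subcells B)) => //.
- move=> w; rewrite !inE => /or3P[/eqP->|/eqP->|/(size_subcells wB)//].
    by rewrite /= size_map sB.
  by rewrite /= size_map sA.
- move=> w z; rewrite !inE => /or3P[/eqP->|/eqP->|wB'] zA zw.
  + move: zw; rewrite inE -mem_pmap_id => /orP[/eqP[e]|/top_labels_sub/dj].
      by rewrite e (negbTE jA) in zA.
    by rewrite zA.
  + split; last by move=> y; rewrite !inE /top_labels mem_pmap_id.
    move: zw; rewrite inE -mem_pmap_id => /orP[/eqP[e]|//].
    by rewrite e (negbTE jA) in zA.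
  + by have /dj := mem_subcells wB' zw; rewrite zA.
- by move=> y; rewrite inE => /orP[/eqP->|//]; rewrite (negbTE jA).
- move=> i k c; rewrite qF; apply: arr_perm; apply/seq.permP => p.
  by rewrite /wA0 /wB0 /cells subcells_node /= !count_cat; lia.
Qed.

Lemma rep_root y (c : 'I_m.+1) : q j y c =
  (nth None (map (@root_label V) A) c == Some y) + (nth None (map (@root_label V) B) c == Some y).
Proof.
have [sA sB wA wB] := rep_parts; rewrite cons_uniq cat_uniq mem_cat negb_or.
case/andP=> /andP[jA jB] /and3P[uA _ uB]; have [_ _ _ _ qF] := rAB.
rewrite qF /cells subcells_node !arr_cons !occ_head arr_cat.
rewrite !index_eq_nth ?(subseq_uniq (top_labels_subseq _)) // !size_map sA sB ltn_ord /=.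
rewrite !arr_notin ?addn0; first by rewrite addnC.
- by move=> w /(size_subcells wB).
- by move=> w /mem_subcells h /h jB'; rewrite jB' in jB.
- by move=> w /(size_subcells wA).
- by move=> w /mem_subcells h /h jA'; rewrite jA' in jA.
Qed.

(** This tells the two cliques of neighbours of j apart: two labels of one cell are joined by an
    arrow of some colour, while labels on opposite sides of j share no cell. *)
Lemma rep_adjacent y z : y != z -> y \in top_labels A -> z \in top_labels A ++ top_labels B ->
  (z \in top_labels A) = [exists c, 0 < q y z c].
Proof.
have [sA sB wA wB] := rep_parts; rewrite cons_uniq cat_uniq mem_cat negb_or.
case/andP=> /andP[jA jB] /and3P[uA /hasPn dj uB]; have [_ _ _ _ qF] := rAB.
move=> yz yA; have yA' := top_labels_sub yA.
have yj : y != j by apply: contraNneq jA => <-.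
have yB : y \notin labels B by apply/negP => /dj; rewrite yA'.
rewrite mem_cat; case zA: (z \in top_labels A) => /= zAB; last first.
  have zB := top_labels_sub zAB.
  have zA' : z \notin labels A by apply: dj.
  have zj : z != j by apply: contraNneq jB => <-.
  symmetry; apply/negbTE; rewrite negb_exists; apply/forallP => c; rewrite -eqn0Ngt.
  rewrite qF arr_notin // => w.
    rewrite inE => /orP[/eqP->|h]; first by rewrite size_map /= sB.
    apply: (size_subcells (F := Node j A :: B)) h.
    by rewrite wf_node sA eqxx wA wB.
  rewrite inE subcells_node inE mem_cat => /or4P[/eqP->|/eqP->|/mem_subcells h _|/mem_subcells h].
  - rewrite inE => /orP[/eqP[e]|]; first by rewrite e eqxx in yj.
    by rewrite -mem_pmap_id => /top_labels_sub; rewrite (negbTE yB).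
  - move=> _; rewrite inE => /orP[/eqP[e]|]; first by rewrite e eqxx in zj.
    by rewrite -mem_pmap_id => /top_labels_sub; rewrite (negbTE zA').
  - by move=> /h; rewrite (negbTE zA').
  - by move=> /h; rewrite (negbTE yB).
have zj : z != j by apply: contraNneq jA => <-; apply: top_labels_sub.
symmetry; apply/existsP; move: yA zA; rewrite /top_labels !mem_pmap_id.
set a := map _ A; have sa : size a = m.+1 by rewrite size_map.
rewrite -!index_mem sa => py pz.
have ua : uniq (pmap id a) := subseq_uniq (top_labels_subseq A) uA.
have ne : index (Some y) a != index (Some z) a.
  apply: contraNneq yz => e; apply/eqP/Some_inj.
  by rewrite -(nth_index None (_ : Some y \in a)) ?e ?nth_index // -index_mem sa.
have [c lc hc] := cyclic_gap py pz ne.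
exists (Ordinal lc); rewrite qF /cells subcells_node !arr_cons.
suff -> : occ (Some j :: a) y z (Ordinal lc) by rewrite addnA addnAC addn1.
by rewrite occ_cons ?sa // py pz.
Qed.
End Root.

Lemma rep_words j A B y z (c : 'I_m.+1) : rep q (Node j A :: B) -> y \in top_labels A ->
  (nth None (map (@root_label V) A) c == Some z) =
    (0 < q j z c) && ((z == y) || [exists c', 0 < q y z c']) /\
  (nth None (map (@root_label V) B) c == Some z) =
    (0 < q j z c) && ~~ ((z == y) || [exists c', 0 < q y z c']).
Proof.
move=> r yA; have [_ _ _ _] := rep_parts r.
rewrite cons_uniq cat_uniq => /and3P[_ _ /andP[/hasPn dj _]].
rewrite (rep_root r); case eA: (_ == _); case eB: (_ == _) => //=.
- have := dj z (top_labels_sub (mem_top_nth eB)).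
  by rewrite (top_labels_sub (mem_top_nth eA)).
- have [//|zy] := eqVneq z y; rewrite -(rep_adjacent r) 1?eq_sym //.
    by rewrite (mem_top_nth eA).
  by rewrite mem_cat (mem_top_nth eA).
- have zB := mem_top_nth eB.
  have zA : z \notin top_labels A by apply: contra (dj z (top_labels_sub zB)) => /top_labels_sub.
  have zy : z != y by apply: contraNneq zA => ->.
  rewrite (negbTE zy) -(rep_adjacent r) 1?eq_sym // ?(negbTE zA) //.
  by rewrite mem_cat zB orbT.
Qed.

(** Fix one neighbour y of j. After swaps, y lies behind j in both forests; adjacency to y then
    fixes the words of both cells at j, and [fits_det] the rest. *)
Lemma rep_det_root j A B A' B' : rep q (Node j A :: B) -> rep q (Node j A' :: B') ->
  req m.+1 (Node j A :: B) (Node j A' :: B').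
Proof.
move=> r r'.
have eqAB A1 B1 A1' B1' : rep q (Node j A1 :: B1) -> rep q (Node j A1' :: B1') ->
    map (@root_label V) A1 = map (@root_label V) A1' ->
    map (@root_label V) B1 = map (@root_label V) B1' -> req m.+1 (Node j A1 :: B1) (Node j A1' :: B1').
  move=> r1 r1' eA eB.
  have -> : A1 = A1'.
    by apply: (fits_det eA (fits_rep r1)); rewrite /top_labels eA; apply: fits_rep r1'.
  have -> : B1 = B1'.
    apply: (fits_det eB (fits_rep (rep_swap r1))).
    by rewrite /top_labels eB; apply: fits_rep (rep_swap r1').
  exact: req_refl.
have [sA sB _ _ un] := rep_parts r; have [sA' sB' _ _ un'] := rep_parts r'.
have [h|] := boolP [exists y, [exists c, 0 < q j y c]]; last first.
  (* Without neighbours of j, both words at j consist of boundary sides only. *)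
  rewrite negb_exists => /forallP h.
  have h0 y c : q j y c = 0.
    by have := h y; rewrite negb_exists => /forallP/(_ c); rewrite lt0n negbK => /eqP.
  by apply: eqAB => //; apply: eq_words => [|y c]; rewrite !size_map ?sA ?sA' ?sB ?sB' // => lc;
    have := h0 y (Ordinal lc); have := h0 y (Ordinal lc);
    rewrite {1}(rep_root r) (rep_root r') /=; do 4 case: (_ == _).
case/existsP: h => y /existsP[c0 qy].
have step A1 B1 A1' B1' : rep q (Node j A1 :: B1) -> rep q (Node j A1' :: B1') ->
    y \in top_labels A1 -> y \in top_labels A1' -> req m.+1 (Node j A1 :: B1) (Node j A1' :: B1').
  move=> r1 r1' y1 y1'; apply: eqAB => //.
    have [s1 _ _ _ _] := rep_parts r1; have [s1' _ _ _ _] := rep_parts r1'.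
    apply: eq_words => [|z c]; rewrite !size_map ?s1 ?s1' // => lc.
    have [e _] := rep_words z (Ordinal lc) r1 y1; have [e' _] := rep_words z (Ordinal lc) r1' y1'.
    exact: etrans e (esym e').
  have [_ s1 _ _ _] := rep_parts r1; have [_ s1' _ _ _] := rep_parts r1'.
  apply: eq_words => [|z c]; rewrite !size_map ?s1 ?s1' // => lc.
  have [_ e] := rep_words z (Ordinal lc) r1 y1; have [_ e'] := rep_words z (Ordinal lc) r1' y1'.
  exact: etrans e (esym e').
have side A1 B1 : rep q (Node j A1 :: B1) -> (y \in top_labels A1) || (y \in top_labels B1).
  move=> r1; move: qy; rewrite (rep_root r1) addn_gt0 !lt0b.
  by case/orP=> /mem_top_nth->; rewrite ?orbT.
have sw A1 B1 : rep q (Node j A1 :: B1) -> req m.+1 (Node j A1 :: B1) (Node j B1 :: A1).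
  by move=> /rep_parts[? ? _ _ _]; apply: req_swap.
have [yA|yB] := orP (side _ _ r); have [yA'|yB'] := orP (side _ _ r').
- exact: step.
- apply: req_trans (step _ _ _ _ r (rep_swap r') yA yB') _.
  exact: sw (rep_swap r').
- exact: req_trans (sw _ _ r) (step _ _ _ _ (rep_swap r) r' yB yA').
- apply: req_trans (sw _ _ r) _.
  apply: req_trans (step _ _ _ _ (rep_swap r) (rep_swap r') yB yB') _.
  exact: sw (rep_swap r').
Qed.

Lemma rep_det (j : V) F F' : rep q F -> rep q F' -> req m.+1 F F'.
Proof.
move=> r r'; have [sF wF _ cF _] := r; have [sF' wF' _ cF' _] := r'.
have [A [B [_ _ h]]] := reroot sF wF (cF j); have [A' [B' [_ _ h']]] := reroot sF' wF' (cF' j).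
apply: (req_trans h); apply: req_trans (req_sym h').
exact: rep_det_root (rep_req h r) (rep_req h' r').
Qed.
End Determination.

(** * Isomorphic quivers and forests of the same shape *)

Section Isomorphism.
Variables (m : nat) (V : finType).

Lemma occ_map (f : V -> V) w i k c : injective f ->
  occ (map (omap f) w) (f i) (f k) c = occ w i k c.
Proof.
move=> fI; have fO : injective (omap f) by apply: inj_omap.
rewrite /occ /after -![Some (f _)]/(omap f (Some _)) mem_map // index_map //.
by rewrite -map_rot behead_map index_map.
Qed.

Lemma unlabel_map (f : V -> V) F : unlabel (map_forest f F) = unlabel F.
Proof.
elim/forest_ind: F => [|F IH|v A F IHA IHF] //; first by rewrite /unlabel /= -!/(unlabel _) IH.
by rewrite map_forest_node /unlabel !map_forest_node -!/(unlabel _) IHA IHF.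
Qed.

Lemma rep_iso (Q Q' : cquiver m V) F : isomorphic Q Q' -> rep Q F ->
  exists2 G, rep Q' G & unlabel G = unlabel F.
Proof.
case=> f [g fK gK] QQ' [sF wF uF cF qF]; have fI := can_inj fK.
exists (map_forest f F); last exact: unlabel_map.
split.
- by rewrite size_map.
- by rewrite wf_map.
- by rewrite labels_map map_inj_uniq.
- by move=> v; rewrite labels_map -(gK v) map_f.
- move=> i k c; rewrite -(gK i) -(gK k) QQ' qF cells_map /arr big_map.
  by apply: eq_bigr => w _; rewrite occ_map.
Qed.

Lemma unlabel_labels_eq (G F : seq (tree V)) (f : V -> V) :
  unlabel G = unlabel F -> map f (labels G) = labels F -> map_forest f G = F.
Proof.
elim/forest_ind: G F => [|G IH|v A G IHA IH] [|[|u B] F] //=.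
  by move=> [e1] e2; rewrite /map_forest /= -/(map_forest f G) (IH F).
move=> [e1 e2]; rewrite !labels_node /= => -[ev]; rewrite map_cat => /eqP.
rewrite eqseq_cat; last first.
  by rewrite size_map -!/(nodes _) -(nodes_map (fun=> tt) A) -(nodes_map (fun=> tt) B) [map_forest _ A]e1.
by move=> /andP[/eqP h1 /eqP h2]; rewrite -!/(map_forest f _) ev (IHA B) ?(IH F).
Qed.

Lemma req_shape_lift a (s s' : seq (tree unit)) : req a s s' ->
  (forall F : seq (tree V), unlabel F = s -> exists2 G, req a F G & unlabel G = s') /\
  (forall F : seq (tree V), unlabel F = s' -> exists2 G, req a F G & unlabel G = s).
Proof.
elim=> [k F|[] A B sA sB|F G _ [IH1 IH2]|F G H _ [IH1 IH2] _ [IH3 IH4]].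
- split=> F1 e; first by exists (rot k F1); [apply: req_rot|rewrite /unlabel /map_forest map_rot -e].
  exists (rot (size F - k) F1); first exact: req_rot.
  by rewrite /unlabel /map_forest map_rot -!/(map_forest _ _) -/(unlabel _) e rot_inv.
- split=> F1 /unlabel_node_inv[v [A' [B' [-> eA eB]]]]; exists (Node v B' :: A').
  + by apply: req_swap; rewrite -(size_unlabel, size_unlabel) ?eA ?eB.
  + by rewrite -eA -eB.
  + by apply: req_swap; rewrite -(size_unlabel, size_unlabel) ?eA ?eB.
  + by rewrite -eA -eB.
- by split.
- split=> F1 e.
    by have [G1 h1 /IH3[G2 h2 e2]] := IH1 _ e; exists G2 => //; apply: req_trans h1 h2.
  by have [G1 h1 /IH2[G2 h2 e2]] := IH4 _ e; exists G2 => //; apply: req_trans h1 h2.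
Qed.

Lemma uniq_bij (v0 : V) (s t : seq V) : uniq s -> uniq t -> size s = size t ->
  (forall v, v \in s) -> (forall v, v \in t) -> exists2 f : V -> V, bijective f & map f s = t.
Proof.
move=> us ut st cs ct.
exists (fun v => nth v0 t (index v s)).
  exists (fun v => nth v0 s (index v t)) => v; rewrite index_uniq ?nth_index //.
    by rewrite -st index_mem.
  by rewrite st index_mem.
apply: (eq_from_nth (x0 := v0)); rewrite size_map // => i li.
by rewrite (nth_map v0) // index_uniq.
Qed.

(** Re-root F to the shape of F'; matching the labels in reading order gives the bijection of
    vertices. *)
Lemma iso_rep (Q Q' : cquiver m V) F F' (v0 : V) : rep Q F -> rep Q' F' ->
  req m.+1 (unlabel F) (unlabel F') -> isomorphic Q Q'.
Proof.
move=> r r' /req_shape_lift[/(_ F erefl)[G hG eG] _].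
have [_ _ uG cG qG] := rep_req hG r; have [_ _ uF' cF' qF'] := r'.
have [|f fb e] := uniq_bij v0 uG uF' _ cG cF'.
  by rewrite -!/(nodes _) -(nodes_map (fun=> tt) G) -(nodes_map (fun=> tt) F') [map_forest _ G]eG.
have eF' := unlabel_labels_eq eG e.
exists f => // i k c; rewrite qF' qG -eF' cells_map /arr big_map.
by apply: eq_bigr => w _; rewrite occ_map //; apply: bij_inj.
Qed.

Lemma iso_shape (Q Q' : cquiver m V) F F' (v0 : V) : rep Q F -> rep Q' F' ->
  isomorphic Q Q' -> req m.+1 (unlabel F) (unlabel F').
Proof.
move=> r r' /rep_iso/(_ r)[G rG <-]; apply: req_map; exact: (rep_det v0 rG r').
Qed.
End Isomorphism.

(** * Counting forests *)

Section Enumeration.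
Variable a : nat.

Definition node_split (F : seq (tree unit)) := Node tt (take a F) :: drop a F.

(* Forests with s nodes and M trees: cutting the first node open turns a forest
   with s.+1 nodes and M.+1 trees into one with s nodes and a + M trees. *)
Fixpoint forests (s : nat) : nat -> seq (seq (tree unit)) :=
  if s is s'.+1 then
    fix go M := if M is M'.+1 then
      map (cons Leaf) (go M') ++ map node_split (forests s' (a + M'))
    else [::]
  else fun M => [:: nseq M Leaf].

Lemma forestsS s M : forests s.+1 M.+1 =
  map (cons Leaf) (forests s.+1 M) ++ map node_split (forests s (a + M)).
Proof. by []. Qed.

Lemma node_splitK v A F : size A = a -> node_split (A ++ F) = Node v A :: F.
Proof. by case: v => sA; rewrite /node_split take_size_cat // drop_size_cat. Qed.

Lemma node_split_inj : injective node_split.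
Proof. by move=> F G [e1 e2]; rewrite -(cat_take_drop a F) e1 e2 cat_take_drop. Qed.

Lemma mem_forests s M F :
  (F \in forests s M) = [&& size F == M, wf a F & nodes F == s].
Proof.
elim: s M F => [|s IHs] M F.
  rewrite inE; apply/eqP/and3P => [->|[/eqP<- _ /eqP/nodes0_leaves//]].
  by rewrite size_nseq wf_leaves nodes_leaves !eqxx.
elim: M F => [|M IHM] F.
  by rewrite in_nil; case: F => //=; rewrite andbF.
rewrite forestsS mem_cat; case: F => [|[|[] A] F].
- by apply/negbTE; rewrite negb_or; apply/andP; split; apply/mapP => -[].
- have -> : (Leaf :: F \in map node_split (forests s (a + M))) = false.
    by apply/mapP => -[].
  by rewrite orbF mem_map ?IHM // => x y [].
- have -> : (Node tt A :: F \in map (cons Leaf) (forests s.+1 M)) = false.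
    by apply/mapP => -[].
  rewrite wf_node nodes_node [size _]/= !eqSS /=.
  apply/mapP/and3P => [[G]|[/eqP sF /and3P[/eqP sA wA wF] nF]].
    rewrite IHs => /and3P[/eqP sG wG nG] [-> ->].
    by rewrite size_takel ?sG ?leq_addr // size_drop sG addKn -wf_cat -nodes_cat cat_take_drop !eqxx.
  exists (A ++ F); last by rewrite (node_splitK tt).
  by rewrite IHs size_cat sA sF wf_cat wA wF nodes_cat nF eqxx.
Qed.

Lemma forests_uniq s M : uniq (forests s M).
Proof.
elim: s M => [|s IHs] M //; elim: M => [|M IHM] //.
rewrite forestsS cat_uniq !map_inj_uniq ?IHM ?IHs //; last 2 first.
- exact: node_split_inj.
- by move=> x y [].
by rewrite andbT; apply/hasPn => x /mapP[G _ ->]; apply/mapP => -[].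
Qed.

Definition nforests s M := size (forests s M).

(** These are the Raney numbers, stated without division. The first tree of a forest is a leaf to be
    dropped or a node to be cut open into a trees, and the formula satisfies this recurrence. *)
Lemma nforestsE s M : 0 < a -> (M + a * s) * nforests s M = M * 'C(M + a * s, s).
Proof.
move=> a0; elim: s M => [|s IHs] M; first by rewrite muln0 addn0 bin0.
elim: M => [|M IHM]; first by rewrite /nforests muln0 mul0n.
rewrite /nforests forestsS size_cat !size_map -!/(nforests _ _).
(* Both terms of the recurrence involve binomials with the same upper entry N, so Pascal's rule
   combines them. *)
set N := M + a * s.+1; have N_gt0 : 0 < N by rewrite addn_gt0 muln_gt0 a0 orbT.
have eN : a + M + a * s = N by rewrite /N; lia.
have := IHs (a + M); rewrite eN => e2; rewrite -/N in IHM.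
rewrite addSn -/N binS; apply/eqP; rewrite -(eqn_pmul2l N_gt0); apply/eqP.
have := mul_bin_left N s; have [d ed] : exists d, N = s + d.
  by exists (N - s); rewrite subnKC // /N; nia.
have -> : N - s = d by lia.
move: IHM e2; set x := nforests _ _; set y := nforests _ _.
set u := 'C(N, s.+1); set v := 'C(N, s) => IHM e2 e3.
have -> : N * (N.+1 * (x + y)) = N.+1 * (N * x + N * y) by lia.
rewrite IHM e2.
have : a * (s.+1 * u) = a * (d * v) by rewrite e3.
have : a * d = a * N - a * s by rewrite ed; lia.
rewrite /N in ed *; nia.
Qed.
End Enumeration.

(** * Necklaces of trees *)

Section Periodic.
Variable T : eqType.
Implicit Types (s p r : seq T).

Lemma iter_rot1 k s : iter k (rot 1) s = rot (k %% size s) s.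
Proof.
case: s => [|x s]; first by rewrite /= modn0; elim: k => //= k ->.
set t := x :: s; have tp : 0 < size t by [].
have small j : j <= size t -> iter j (rot 1) t = rot j t.
  elim: j => [|j IH] lj; first by rewrite rot0.
  by rewrite iterS IH ?(ltnW lj) // -rotS.
have full j : iter (j * size t) (rot 1) t = t.
  by elim: j => // j IH; rewrite mulSn iterD IH small // rot_size.
by rewrite {1}(divn_eq k (size t)) addnC iterD full small // ltnW // ltn_mod.
Qed.

Lemma iter_mul_fix (f : seq T -> seq T) k j s : iter k f s = s -> iter (j * k) f s = s.
Proof. by move=> h; elim: j => // j IH; rewrite mulSn iterD IH. Qed.

(** By Bezout, the gcd is a multiple of k up to multiples of the full turn. *)
Lemma iter_rot1_gcd k s : (iter k (rot 1) s == s) = (iter (gcdn k (size s)) (rot 1) s == s).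
Proof.
have full : iter (size s) (rot 1) s = s by rewrite iter_rot1 modnn rot0.
apply/eqP/eqP => h.
  have [->|k_gt0] := posnP k; first by rewrite gcd0n.
  case: (egcdnP (size s) k_gt0) => km kn e _.
  have := iter_mul_fix km h; rewrite e addnC iterD (iter_mul_fix kn full) //.
have /dvdnP[j ->] := dvdn_gcdl k (size s).
exact: iter_mul_fix.
Qed.

Definition repeat d p := flatten (nseq d p).

Lemma repeat_comm d p : repeat d p ++ p = p ++ repeat d p.
Proof. by elim: d => [|d IH]; rewrite ?cats0 // /repeat /= -catA [flatten _ ++ p]IH. Qed.

Lemma size_repeat d p : size (repeat d p) = d * size p.
Proof. by elim: d => // d IH; rewrite /repeat /= size_cat [size (flatten _)]IH mulSn. Qed.

Lemma comm_repeat e p r : size r = e * size p -> r ++ p = p ++ r -> r = repeat e p.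
Proof.
elim: e r => [|e IH] r sr h; first by apply: size0nil.
have er : r = p ++ drop (size p) r.
  have := congr1 (take (size p)) h; rewrite [take _ (p ++ r)]take_size_cat // take_cat.
  case: ltnP => [_ e1|le]; first by rewrite -{1}(cat_take_drop (size p) r) e1.
  have : size r = size p by move: sr le; rewrite mulSn; lia.
  move=> e2; rewrite e2 subnn take0 cats0 => e3.
  by rewrite -e2 drop_size cats0.
move: h; rewrite er -catA => /eqP; rewrite eqseq_cat // eqxx /= => /eqP h.
rewrite /repeat /= -/(repeat e p) -(IH _ _ h) //.
by rewrite size_drop sr mulSn addKn.
Qed.

Lemma iter_rot1_repeat g d s : size s = d * g -> 0 < d ->
  (iter g (rot 1) s == s) = (s == repeat d (take g s)).
Proof.
case: d => // d sd _.
have lg : g <= size s by rewrite sd leq_pmull.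
have sT : size (take g s) = g by rewrite size_takel.
have -> : iter g (rot 1) s = rot g s.
  rewrite iter_rot1; move: lg; rewrite leq_eqVlt => /predU1P[->|lt].
    by rewrite modnn rot0 rot_size.
  by rewrite modn_small.
apply/eqP/eqP => [h|h].
  rewrite /repeat /= -/(repeat d _) -{1}(cat_take_drop g s); congr (_ ++ _).
  apply: comm_repeat; first by rewrite size_drop sT sd mulSn addKn.
  by rewrite cat_take_drop.
have {2}-> : s = take g s ++ repeat d (take g s) by rewrite {1}h.
rewrite {1}h /repeat /= -/(repeat d _) -{1}sT rot_size_cat.
by rewrite repeat_comm.
Qed.
End Periodic.

Lemma nodes_repeat V d (p : seq (tree V)) : nodes (flatten (nseq d p)) = d * nodes p.
Proof. by elim: d => //= d IH; rewrite nodes_cat IH mulSn. Qed.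

Lemma wf_repeat V a d (p : seq (tree V)) : 0 < d -> wf a (flatten (nseq d p)) = wf a p.
Proof. by case: d => // d _; elim: d => [|d IH] /=; rewrite ?cats0 // wf_cat IH andbb. Qed.

Section Necklaces.
Variable a : nat.
Definition forest s M := seq_sub (forests a s M).

Lemma card_forest s M : #|{: forest s M}| = nforests a s M.
Proof. by rewrite card_seq_sub ?forests_uniq. Qed.

Lemma forestP s M (x : forest s M) : [/\ size (val x) = M, wf a (val x) & nodes (val x) = s].
Proof. by have := valP x; rewrite mem_forests => /and3P[/eqP ? ? /eqP ?]. Qed.

Lemma size_forest s M (x : forest s M) : size (val x) = M. Proof. by case: (forestP x). Qed.

Lemma iter_rot_forest s M k F : F \in forests a s M -> iter k (rot 1) F \in forests a s M.
Proof. by rewrite !mem_forests iter_rot1 size_rot wf_rot nodes_rot. Qed.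

(** A forest fixed by the rotation by k consists of d copies of its first g trees, which hold s / d
    nodes. *)
Lemma fix_count s M k : 0 < M ->
  #|[set x : forest s M | iter k (rot 1) (val x) == val x]| =
  let g := gcdn k M in let d := M %/ g in
  if d %| s then nforests a (s %/ d) g else 0.
Proof.
move=> M0 /=; set g := gcdn k M; set d := M %/ g.
have dg : d * g = M by rewrite divnK // dvdn_gcdr.
have d0 : 0 < d by move: M0; rewrite -dg; case: (d).
have fixE (x : forest s M) : (iter k (rot 1) (val x) == val x) = (val x == repeat d (take g (val x))).
  by rewrite iter_rot1_gcd size_forest -/g (@iter_rot1_repeat _ g d) ?size_forest.
have nE (x : forest s M) : val x == repeat d (take g (val x)) -> s = d * nodes (take g (val x)).
  move=> /eqP e; case: (forestP x) => _ _; rewrite {1}e nodes_repeat => ->//.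
have [/dvdnP[e se]|nd] := boolP (d %| s); last first.
  apply: eq_card0 => x; rewrite inE fixE; apply/negP => /nE e.
  by rewrite e dvdn_mulr in nd.
have -> : s %/ d = e by rewrite se mulnK.
rewrite -card_forest.
have memG (G : forest e g) : repeat d (val G) \in forests a s M.
  case: (forestP G) => sG wG nG.
  by rewrite mem_forests size_repeat sG dg wf_repeat // nodes_repeat nG wG eqxx se mulnC eqxx.
pose h (G : forest e g) : forest s M := SeqSub (memG G).
have takeK (G : forest e g) : take g (val (h G)) = val G.
  rewrite /= /repeat -(prednK d0) /= take_size_cat //; exact: size_forest.
have hI : injective h by move=> G G' e'; apply: val_inj; rewrite -!takeK e'.
rewrite -(card_imset _ hI); apply: eq_card => x; rewrite inE fixE.
apply/idP/imsetP => [ex|[G _ ->]]; last by rewrite takeK.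
have n1 : nodes (take g (val x)) = e.
  by apply/eqP; rewrite -(eqn_pmul2l d0) -nE // se mulnC.
have m1 : take g (val x) \in forests a e g.
  rewrite mem_forests n1 eqxx andbT; case: (forestP x) => sx wx _.
  have lg : g <= M by apply: dvdn_leq => //; apply: dvdn_gcdr.
  rewrite size_takel ?sx // eqxx /=.
  by move: wx; rewrite -{1}(cat_take_drop g (val x)) wf_cat => /andP[].
exists (SeqSub m1) => //; apply: val_inj => /=; exact/eqP.
Qed.

Variables (s m : nat).
Local Notation M := m.+2.

Definition rot_forest (x : forest s M) (k : 'I_M) : forest s M :=
  SeqSub (iter_rot_forest k (valP x)).

Lemma rot_forest1 : rot_forest^~ 1%g =1 id.
Proof. by move=> x; apply: val_inj. Qed.

Lemma rot_forestM x : act_morph rot_forest x.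
Proof.
move=> k l; apply: val_inj => /=; rewrite -iterD.
by rewrite !iter_rot1 size_forest modn_mod addnC.
Qed.

Definition rot_action := TotalAction rot_forest1 rot_forestM.

Definition necklace (x : forest s M) : {set forest s M} := orbit rot_action setT x.

Lemma mem_necklace x y : reflect (exists k, val y = iter k (rot 1) (val x)) (y \in necklace x).
Proof.
apply: (iffP orbitP) => [[k _ <-]|[k e]]; first by exists k.
exists (inord (k %% M)) => //; apply: val_inj; rewrite /= e.
by rewrite !iter_rot1 size_forest inordK ?modn_mod // ltn_mod.
Qed.

Lemma necklace_refl x : x \in necklace x. Proof. exact: orbit_refl. Qed.

Lemma necklace_eq x y : y \in necklace x -> necklace y = necklace x.
Proof. by move=> h; apply/eqP; rewrite orbit_eq_mem. Qed.

Lemma necklace_count :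
  #|necklace @: setT| * M = \sum_(0 <= k < M)
    let g := gcdn k M in let d := M %/ g in if d %| s then nforests a (s %/ d) g else 0.
Proof.
have := @Frobenius_Cauchy _ _ _ rot_action [set: 'I_M]%G setT.
rewrite cardsT card_ord => <-; last by apply/actsP => k _ x; rewrite !inE.
rewrite big_mkord; apply: eq_big => [k|k _]; first by rewrite inE.
rewrite -fix_count //; apply: eq_card => x.
by rewrite !inE sub1set inE -val_eqE.
Qed.
End Necklaces.

Arguments necklace {a s m} x.

(** * Re-rooting classes through centroids *)

(** Each fibre of f is an orbit of g: two points, or one point that is counted again as a fixed
    point. *)
Lemma involution_classes (T U : finType) (E : {set T}) (f : T -> U) (g : T -> T) :
  {in E, forall x, g x \in E} ->
  {in E &, forall x y, f x = f y <-> y = x \/ y = g x} ->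
  2 * #|f @: E| = #|E| + #|[set x in E | g x == x]|.
Proof.
move=> gE fE; rewrite mulnC -sum_nat_const.
have cE (D : {set T}) : D \subset E -> #|D| = \sum_(y in f @: E) #|[set x in D | f x == y]|.
  move=> /subsetP sD; rewrite -sum1_card (partition_big f [in f @: E]) /=; last first.
    by move=> x /sD; apply: imset_f.
  by apply: eq_bigr => y _; rewrite -sum1_card; apply: eq_bigl => x; rewrite inE.
rewrite (cE E) // (cE [set x in E | g x == x]); last by apply/subsetP => x; rewrite inE => /andP[].
rewrite -big_split; apply: eq_bigr => _ /imsetP[x xE ->] /=.
have gxE := gE x xE.
have fg : f (g x) = f x by apply/esym/fE => //; right.
have fib y : y \in E -> f y = f x -> y = x \/ y = g x by move=> yE /esym; apply: (fE x y xE yE).1.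
have [gx|gx] := eqVneq (g x) x.
  rewrite !(@eq_card1 _ x) // => y; rewrite !inE.
    apply/idP/eqP => [/andP[/andP[yE _] /eqP/(fib y yE)[//|]]|->]; first by rewrite gx.
    by rewrite xE gx !eqxx.
  apply/idP/eqP => [/andP[yE /eqP/(fib y yE)[//|]]|->]; first by rewrite gx.
  by rewrite xE eqxx.
rewrite (_ : [set y in E | f y == f x] = [set x; g x]); last first.
  apply/setP => y; rewrite !inE; apply/andP/orP => [[yE /eqP/(fib y yE)[->|->]]|].
  - by left.
  - by right.
  - by case=> /eqP->; rewrite ?xE ?gxE ?fg eqxx.
rewrite cards2 eq_sym gx eq_card0 // => y; rewrite !inE; apply/negP.
case/andP=> /andP[yE /eqP gy] /eqP/(fib y yE)[e|e].
  by move/eqP: gx; apply; rewrite -e.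
have [e'|e'] : x = y \/ x = g y by apply: (fE y x yE xE).1; rewrite e.
  by move/eqP: gx; apply; rewrite -e.
by move/eqP: gx; apply; rewrite -e -gy.
Qed.

Section Centroid.
Variables (m n : nat).
Local Notation a := m.+1.
Local Notation M := m.+2.
Implicit Types (F G A B : seq (tree unit)) (t : tree unit).

(* A forest with n nodes has n.+1 cells; a tree hanging from the root cell is big when
   it contains more than half of them, and the root then has to be moved into it. *)
Definition tsize t := nodes [:: t].
Definition big_tree t := n.+1 < 2 * tsize t.
Definition half_tree t := 2 * tsize t == n.+1.
Definition special t := n.+1 <= 2 * tsize t.

Lemma tsize_node v A : tsize (Node v A) = (nodes A).+1.
Proof. by rewrite /tsize nodes_node addn0. Qed.

Lemma nodes_tsize t F : nodes (t :: F) = tsize t + nodes F.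
Proof. exact: nodes_cons. Qed.

Lemma specialE t : special t = big_tree t || half_tree t.
Proof. by rewrite /special /big_tree /half_tree; lia. Qed.

Lemma count_special F : count special F * n.+1 <= 2 * nodes F.
Proof.
elim: F => // t F IH; rewrite nodes_tsize /= mulnDl mulnDr leq_add // /special.
by case: leqP => // h; rewrite mul1n.
Qed.

(** Two special trees would together hold at least n + 1 nodes. Uniqueness is what makes [front] a
    canonical rotation. *)
Lemma count_special1 F : nodes F = n -> count special F <= 1.
Proof. by move=> nF; have := count_special F; rewrite nF; nia. Qed.

Definition front (p : pred (tree unit)) F := rot (find p F) F.
Definition swap F := if F is Node v A :: B then Node v B :: A else F.

Lemma front_rot p k F : nodes F = n -> subpred p special -> has p F ->
  front p (iter k (rot 1) F) = front p F.
Proof.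
move=> nF ps; rewrite has_count iter_rot1 => c0; apply: rot_find.
have := sub_count ps F; have := count_special1 nF; lia.
Qed.

Lemma front_head p F : has p F -> exists t G, [/\ front p F = t :: G & p t].
Proof.
move=> hp; rewrite /front /rot (drop_nth Leaf); last by rewrite -has_find.
by do 2 eexists; split; [reflexivity|apply: nth_find].
Qed.

Lemma special_node t : special t -> exists A, t = Node tt A.
Proof. by case: t => [|[] A] // _; exists A. Qed.

Lemma big_special : subpred big_tree special. Proof. by move=> t; rewrite specialE => ->. Qed.
Lemma half_special : subpred half_tree special. Proof. by move=> t; rewrite specialE orbC => ->. Qed.

Lemma front_node p F : subpred p special -> has p F ->
  exists A B, front p F = Node tt A :: B /\ p (Node tt A).
Proof.
move=> ps /front_head[t [G [e pt]]]; have [A eA] := special_node (ps t pt).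
by exists A, G; rewrite e -eA.
Qed.

Lemma front_id p F : ohead F != None -> oapp p false (ohead F) -> front p F = F.
Proof. by case: F => //= t F _ pt; rewrite /front /= pt rot0. Qed.

Local Notation U F := (F \in forests a n M).

Lemma UP F : U F -> [/\ size F = M, wf a F & nodes F = n].
Proof. by rewrite mem_forests => /and3P[/eqP ? ? /eqP ?]. Qed.

Lemma U_req F G : req a F G -> U F = U G.
Proof.
move=> h; rewrite !mem_forests (req_size h) (req_wf h).
by rewrite /nodes (perm_size (req_labels h)).
Qed.

Lemma U_rot k F : U (iter k (rot 1) F) = U F.
Proof. by apply/esym/U_req; rewrite iter_rot1; apply: req_rot. Qed.

Lemma req_front p F : req a F (front p F).
Proof. exact: req_rot. Qed.

Lemma U_node v A B : U (Node v A :: B) -> [/\ size A = a, size B = a & (nodes A + nodes B).+1 = n].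
Proof. by move=> /UP[[sB]]; rewrite wf_node nodes_node => /and3P[/eqP sA _ _]. Qed.

Lemma req_swapU F : U F -> req a F (swap F).
Proof.
case: F => [|[|v A] B]; [by move=> _; apply: req_refl..|].
by move=> /U_node[sA sB _]; apply: req_swap.
Qed.

Definition down F := if has big_tree F then swap (front big_tree F) else F.

Lemma req_down F : U F -> req a F (down F).
Proof.
move=> uF; rewrite /down; case: ifP => _; last exact: req_refl.
by apply: req_trans (req_front _ _) (req_swapU _); rewrite -(U_req (req_front _ _)).
Qed.

Lemma U_down F : U F -> U (down F).
Proof. by move=> uF; rewrite -(U_req (req_down uF)). Qed.

(** The new root cell sees the children of the big tree, which are smaller than it, and the other
    side of the crossed edge, which has less than half of the cells. *)
Lemma down_small F k : U F -> has big_tree F -> all (fun t => tsize t <= k.+1) F ->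
  all (fun t => tsize t <= k) (down F).
Proof.
move=> uF hF kF; rewrite /down hF.
have [A [B [e bA]]] := front_node big_special hF.
have := uF; rewrite (U_req (req_front big_tree F)) e => /U_node[_ _ nAB].
have : all (fun t => tsize t <= k.+1) (front big_tree F).
  by rewrite /front /rot all_cat andbC -all_cat cat_take_drop.
rewrite e /= !tsize_node ltnS => /andP[kA _].
move: bA; rewrite /big_tree tsize_node => bA; apply/andP; split; first by lia.
apply/allP => t tA; apply: leq_trans kA.
by case/splitPr: tA {bA nAB e} => A1 A2; rewrite nodes_cat nodes_tsize; lia.
Qed.

Lemma has_big_iter k F : U F -> all (fun t => tsize t <= k) F ->
  ~~ has big_tree (iter k down F).
Proof.
elim: k F => [|k IH] F uF kF.
  apply/hasPn => t /(allP kF); rewrite /big_tree; lia.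
rewrite iterSr; have [hF|hF] := boolP (has big_tree F).
  by apply: IH; [apply: U_down|apply: down_small].
have dF : down F = F by rewrite /down (negbTE hF).
by rewrite dF; have -> : iter k down F = F by elim: k {IH kF} => //= k ->.
Qed.

(** Trees have at most n nodes and each genuine step lowers this bound, so n steps suffice. *)
Definition central F := iter n down F.

Lemma tsize_le F t : t \in F -> tsize t <= nodes F.
Proof. by case/splitPr => A1 A2; rewrite nodes_cat nodes_tsize; lia. Qed.

Lemma central_nobig F : U F -> ~~ has big_tree (central F).
Proof.
move=> uF; apply: has_big_iter => //; apply/allP => t /tsize_le.
by case: (UP uF) => _ _ ->.
Qed.

Lemma U_central F : U F -> U (central F).
Proof.
move=> uF; have h k : U (iter k down F) by elim: k => //= k; exact: U_down.
exact: h.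
Qed.

Lemma req_central F : U F -> req a F (central F).
Proof.
move=> uF; suff h k : U (iter k down F) /\ req a F (iter k down F) by case: (h n).
elim: k => [|k [uk rk]]; first by split=> //; apply: req_refl.
by rewrite iterS; split; [apply: U_down|apply: req_trans rk (req_down uk)].
Qed.

Lemma central_id F : ~~ has big_tree F -> central F = F.
Proof.
move=> hF; have dF : down F = F by rewrite /down (negbTE hF).
by have h k : iter k down F = F; [elim: k => //= k ->|exact: h].
Qed.

Lemma central_down F : U F -> central (down F) = central F.
Proof.
move=> uF; rewrite /central -iterSr iterS {1}/down -/(central F).
by rewrite (negbTE (central_nobig uF)).
Qed.

Definition rots F G := exists k, G = iter k (rot 1) F.
Definition tie F := if has half_tree F then swap (front half_tree F) else F.

(* [ceq F G]: G is F up to rotation and, when an edge of F cuts it into two equal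
   halves, up to crossing that edge. *)
Definition ceq F G := rots F G \/ rots (tie F) G.

Lemma rots_refl F : rots F F. Proof. by exists 0. Qed.
Lemma rots_trans F G H : rots F G -> rots G H -> rots F H.
Proof. by move=> [k ->] [l ->]; exists (l + k); rewrite iterD. Qed.
Lemma rots_sym F G : rots F G -> rots G F.
Proof.
move=> [k ->]; exists (size F * k - k); rewrite -iterD iter_rot1.
case: F => // x F; rewrite subnK; last by rewrite leq_pmull.
by rewrite modnMr rot0.
Qed.
Lemma rots_rot k F : rots F (rot k F).
Proof.
have [lt|ge] := ltnP k (size F); first by exists k; rewrite iter_rot1 modn_small.
by rewrite rot_oversize //; apply: rots_refl.
Qed.

Lemma tie_rots F G : nodes F = n -> rots F G -> rots (tie F) (tie G).
Proof.
move=> nF [k ->]; rewrite /tie.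
have -> : has half_tree (iter k (rot 1) F) = has half_tree F by rewrite iter_rot1 has_rot.
case: ifP => [hF|_]; last by exists k.
by rewrite front_rot //; [apply: rots_refl|apply: half_special].
Qed.

Lemma ceq_rots F G H : nodes F = n -> rots F G -> (ceq F H <-> ceq G H).
Proof.
move=> nF FG; have tFG := tie_rots nF FG.
by split=> -[h|h]; [left|right|left|right]; apply: rots_trans h => //; apply: rots_sym.
Qed.

Lemma central_rots F G : U F -> rots F G -> rots (central F) (central G).
Proof.
move=> uF [k ->]; case: (UP uF) => _ _ nF.
have hk : has big_tree (iter k (rot 1) F) = has big_tree F by rewrite iter_rot1 has_rot.
have [hF|hF] := boolP (has big_tree F).
  rewrite -central_down // -[central (iter _ _ _)]central_down ?U_rot //.
  by rewrite /down hk hF front_rot //; [apply: rots_refl|apply: big_special].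
by rewrite !central_id ?hk //; exists k.
Qed.

Lemma tie_swap v A B : U (Node v A :: B) -> half_tree (Node v A) ->
  tie (Node v A :: B) = Node v B :: A.
Proof. by move=> uF hA; rewrite /tie /= hA /front /= hA rot0. Qed.

Lemma half_swap v A B : U (Node v A :: B) -> half_tree (Node v A) = half_tree (Node v B).
Proof. by move=> /U_node[_ _ e]; rewrite /half_tree !tsize_node; lia. Qed.

Lemma half_nobig v A B : U (Node v A :: B) -> half_tree (Node v A) ->
  ~~ has big_tree (Node v A :: B).
Proof.
move=> /U_node[_ _ e] hA; apply/hasPn => t; rewrite inE => /orP[/eqP->|/tsize_le tB].
  by move: hA; rewrite /half_tree /big_tree; lia.
by move: hA; rewrite /half_tree /big_tree tsize_node; lia.
Qed.

Lemma U_tie F : U F -> U (tie F).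
Proof.
move=> uF; rewrite /tie; case: ifP => // _.
have uf : U (front half_tree F) by rewrite -(U_req (req_front _ _)).
by rewrite -(U_req (req_swapU uf)).
Qed.

Lemma req_tie F : U F -> req a F (tie F).
Proof.
move=> uF; rewrite /tie; case: ifP => _; last exact: req_refl.
have uf : U (front half_tree F) by rewrite -(U_req (req_front _ _)).
exact: req_trans (req_front _ _) (req_swapU uf).
Qed.

Lemma req_rots F G : rots F G -> req a F G.
Proof. by move=> [k ->]; rewrite iter_rot1; apply: req_rot. Qed.

(** Only a swap needs an argument: if the parts at the crossed edge differ in size, [down] leads
    from one of the two forests to the other; if they are equal, [tie] exchanges the two. *)
Lemma req_ceq F G : req a F G -> U F -> forall H, ceq (central F) H <-> ceq (central G) H.
Proof.
elim=> [k K|v A B sA sB|K L h IH|K L N h1 IH1 h2 IH2] uF H.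
- apply: ceq_rots; first by case: (UP (U_central uF)).
  by apply: central_rots => //; apply: rots_rot.
- have [_ _ nAB] := U_node uF.
  have uG : U (Node v B :: A) by rewrite -(U_req (req_swap _ sA sB)).
  have bigE v' A' B' : big_tree (Node v' A') -> down (Node v' A' :: B') = Node v' B' :: A'.
    by move=> b; rewrite /down /= b /front /= b rot0.
  case: (ltngtP (nodes A) (nodes B)) => AB.
  + rewrite -(central_down uG) bigE //.
    by rewrite /big_tree tsize_node; lia.
  + rewrite -(central_down uF) bigE //.
    by rewrite /big_tree tsize_node; lia.
  + have hA : half_tree (Node v A) by rewrite /half_tree tsize_node; lia.
    have hB : half_tree (Node v B) by rewrite -(half_swap uF).
    rewrite !central_id ?(half_nobig uF) ?(half_nobig uG) // /ceq !tie_swap //.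
    by split=> -[]; tauto.
- by rewrite IH // (U_req h).
- by rewrite IH1 // IH2 // -(U_req h1).
Qed.

Local Notation FT := (forest a n M).
Definition centralT (x : FT) : FT := SeqSub (U_central (valP x)).
Definition tieT (x : FT) : FT := SeqSub (U_tie (valP x)).
(** A finite set that stands for the re-rooting class of x, so that classes can be counted as
    images; [cls_req] shows that it characterises the class. *)
Definition cls (x : FT) := necklace (centralT x) :|: necklace (tieT (centralT x)).

Lemma mem_cls x y : y \in cls x <-> ceq (central (val x)) (val y).
Proof.
rewrite inE; split=> [/orP[/mem_necklace h|/mem_necklace h]|[h|h]]; [by left|by right| |].
  by apply/orP; left; apply/mem_necklace.
by apply/orP; right; apply/mem_necklace.
Qed.

Lemma cls_req x y : cls x = cls y <-> req a (val x) (val y).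
Proof.
split=> [e|h]; last first.
  by apply/setP => z; apply/idP/idP => /mem_cls h'; apply/mem_cls; apply/(req_ceq h (valP x)).
have : centralT y \in cls x by rewrite e inE necklace_refl.
have uy := valP y; have ux := valP x.
move=> /mem_cls h; apply: req_trans (req_central ux) _; apply: req_trans (req_sym (req_central uy)).
case: h => /req_rots // h; apply: req_trans h; exact: req_tie (U_central ux).
Qed.

Definition nospecial : {set FT} := [set x | ~~ has special (val x)].
Definition havespecial : {set FT} := [set x | has special (val x)].
Definition havehalf : {set FT} := [set x | has half_tree (val x)].

Lemma has_half_nobig F : U F -> has half_tree F -> ~~ has big_tree F.
Proof.
move=> uF hF; have [A [B [e hA]]] := front_node half_special hF.
have uf : U (front half_tree F) by rewrite -(U_req (req_front _ _)).
have : ~~ has big_tree (front half_tree F) by move: uf; rewrite e => uf; apply: half_nobig.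
by rewrite /front has_rot.
Qed.

Lemma rots_has p F G : rots F G -> has p F = has p G.
Proof. by move=> [k ->]; rewrite iter_rot1 has_rot. Qed.

Lemma nospecial_cls x : x \in nospecial -> cls x = necklace x.
Proof.
rewrite inE => hx.
have hb : ~~ has big_tree (val x) by apply: contra hx => /(sub_has big_special).
have hh : has half_tree (val x) = false by apply/negbTE; apply: contra hx => /(sub_has half_special).
have e : centralT x = x by apply: val_inj; rewrite /= central_id.
have e' : tieT x = x by apply: val_inj; rewrite /= /tie hh.
by rewrite /cls e e' setUid.
Qed.

Lemma tie_half F : U F -> has half_tree F -> has half_tree (tie F).
Proof.
move=> uF hF; rewrite /tie hF; have [A [B [e hA]]] := front_node half_special hF.
have uf : U (front half_tree F) by rewrite -(U_req (req_front _ _)).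
by rewrite e in uf *; rewrite /= -(half_swap uf) hA.
Qed.

(** A centre has no big tree: either it has no special tree, and the class reduces to one necklace,
    or it has a halving edge. *)
Lemma card_cls : #|cls @: setT| = #|necklace @: nospecial| + #|cls @: havehalf|.
Proof.
have -> : cls @: setT = cls @: nospecial :|: cls @: havehalf.
  apply/setP => c; apply/imsetP/setUP => [[x _ ->]|].
    have -> : cls x = cls (centralT x) by apply/cls_req/req_central/valP.
    have nb : ~~ has big_tree (val (centralT x)) by apply/central_nobig/valP.
    have [h|h] := boolP (has half_tree (val (centralT x))).
      by right; apply: imset_f; rewrite inE.
    left; apply: imset_f; rewrite inE; apply/hasPn => t tx.
    by rewrite specialE negb_or (hasPn nb _ tx) (hasPn h _ tx).
  by case=> /imsetP[x _ ->]; exists x.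
rewrite cardsU; have -> : cls @: nospecial = necklace @: nospecial.
  by apply: eq_in_imset => x; apply: nospecial_cls.
have -> : necklace @: nospecial :&: cls @: havehalf = set0.
  apply/setP => c; rewrite !inE; apply/negP => /andP[/imsetP[x hx ->] /imsetP[y hy e]].
  have /mem_cls : x \in cls y by rewrite -e necklace_refl.
  move: hy hx; rewrite [x \in _]inE [y \in _]inE => hy hx.
  rewrite (central_id (has_half_nobig (valP y) hy)) => -[]/(rots_has half_tree) e'.
    by move: hx; rewrite (sub_has half_special) // -e'.
  by move: hx; rewrite (sub_has half_special) // -e' (tie_half (valP y)).
by rewrite cards0 subn0.
Qed.

Lemma card_necklace : #|necklace @: [set: FT]| = #|necklace @: nospecial| + #|necklace @: havespecial|.
Proof.
have -> : necklace @: [set: FT] = necklace @: nospecial :|: necklace @: havespecial.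
  rewrite -imsetU; have -> // : nospecial :|: havespecial = setT.
  by apply/setP => x; rewrite !inE; case: (has _ _).
rewrite cardsU; have -> : necklace @: nospecial :&: necklace @: havespecial = set0.
  apply/setP => c; rewrite !inE; apply/negP => /andP[/imsetP[x hx ->] /imsetP[y hy e]].
  have /mem_necklace/(rots_has special) e' : x \in necklace y by rewrite -e necklace_refl.
  move: hy hx; rewrite [x \in _]inE [y \in _]inE => hy hx.
  by rewrite -e' hy in hx.
by rewrite cards0 subn0.
Qed.
End Centroid.

(** * Forests with a distinguished edge *)

Section Pairs.
Variables (m n : nat).
Local Notation a := m.+1.
Local Notation M := m.+2.
Local Notation FT := (forest a n.+1 M).
Local Notation PT := (forest a n (a + a)).

(* A pair of forests is a cell-rooted forest with a distinguished edge at its root. *)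
Lemma node_split_forest F : F \in forests a n (a + a) -> node_split a F \in forests a n.+1 M.
Proof.
rewrite !mem_forests => /and3P[/eqP sF wF /eqP nF].
have sT : size (take a F) = a by rewrite size_takel // sF leq_addr.
rewrite wf_node nodes_node -nodes_cat -wf_cat cat_take_drop nF wF sT !eqxx /= size_drop sF.
by rewrite addKn eqxx.
Qed.

Definition graft (X : PT) : FT := SeqSub (node_split_forest (valP X)).
Definition flip_pair (X : PT) : PT := SeqSub (iter_rot_forest a (valP X)).

Lemma val_graft X : val (graft X) = Node tt (take a (val X)) :: drop a (val X).
Proof. by []. Qed.

Lemma graft_inj : injective graft.
Proof. by move=> X Y /(congr1 val)/node_split_inj/val_inj. Qed.

Lemma flip_pairE X : val (flip_pair X) = drop a (val X) ++ take a (val X).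
Proof.
rewrite -[val _]/(iter a (rot 1) (val X)) iter_rot1.
have -> // : a %% size (val X) = a.
by rewrite size_forest modn_small //; lia.
Qed.

Lemma take_flip X : take a (val (flip_pair X)) = drop a (val X).
Proof. by rewrite flip_pairE take_size_cat // size_drop size_forest addKn. Qed.
Lemma drop_flip X : drop a (val (flip_pair X)) = take a (val X).
Proof. by rewrite flip_pairE drop_size_cat // size_drop size_forest addKn. Qed.

Lemma flip_pairK : involutive flip_pair.
Proof.
by move=> X; apply: val_inj; rewrite flip_pairE take_flip drop_flip cat_take_drop.
Qed.

Lemma nodes_pair (X : PT) : nodes (take a (val X)) + nodes (drop a (val X)) = n.
Proof. by rewrite -nodes_cat cat_take_drop; case: (forestP X). Qed.

Definition pair_ge : {set PT} := [set X | nodes (drop a (val X)) <= nodes (take a (val X))].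
Definition pair_eq : {set PT} := [set X | nodes (drop a (val X)) == nodes (take a (val X))].

(** Exchanging the members matches the pairs outside [pair_ge] with the unbalanced ones inside. *)
Lemma card_pair_ge : 2 * #|pair_ge| = #|{: PT}| + #|pair_eq|.
Proof.
have -> : #|{: PT}| = #|pair_ge| + #|~: pair_ge| by rewrite cardsC.
have -> : #|~: pair_ge| = #|flip_pair @: ~: pair_ge| by rewrite card_imset //; apply: inv_inj flip_pairK.
rewrite mul2n -addnn -addnA; congr (_ + _).
rewrite -(cardsID pair_eq pair_ge) addnC; congr (_ + _); last first.
  by apply: eq_card => X; rewrite !inE; lia.
apply: eq_card => X; rewrite -{2}(flip_pairK X) (mem_imset _ _ (inv_inj flip_pairK)).
rewrite !inE take_flip drop_flip. by rewrite -ltnNge ltn_neqAle.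
Qed.

Lemma graft_special X : special n.+1 (Node tt (take a (val X))) = (X \in pair_ge).
Proof.
have := nodes_pair X; rewrite /special tsize_node inE.
by move: (nodes (take a (val X))) (nodes (drop a (val X))) => p r; lia.
Qed.
Lemma graft_half X : half_tree n.+1 (Node tt (take a (val X))) = (X \in pair_eq).
Proof.
have := nodes_pair X; rewrite /half_tree tsize_node inE.
by move: (nodes (take a (val X))) (nodes (drop a (val X))) => p r; lia.
Qed.

Lemma front_graft X : X \in pair_ge -> front (special n.+1) (val (graft X)) = val (graft X).
Proof. by move=> h; apply: front_id; rewrite //= graft_special. Qed.

Lemma graft_front (x : FT) p : subpred p (special n.+1) -> has p (val x) ->
  exists2 X, val (graft X) = front p (val x) & p (Node tt (take a (val X))).
Proof.
move=> ps hp; have [A [B [e pA]]] := front_node ps hp.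
have := valP x; rewrite (U_req _ (req_front _ p _)) e => uf.
have [sA sB nAB] := U_node uf.
have mX : A ++ B \in forests a n (a + a).
  move: uf; rewrite !mem_forests wf_node => /and3P[_ /and3P[_ wA wB] _].
  by rewrite size_cat sA sB wf_cat wA wB nodes_cat !eqxx /= -eqSS nAB.
exists (SeqSub mX); first by rewrite /= (node_splitK tt).
by rewrite /= take_size_cat.
Qed.

Lemma necklace_graft X Y : X \in pair_ge -> Y \in pair_ge ->
  graft Y \in necklace (graft X) -> Y = X.
Proof.
move=> hX hY /mem_necklace[k e]; apply: graft_inj; apply: val_inj.
rewrite -(front_graft hY) e (@front_rot n.+1) ?front_graft //; first by case: (forestP (graft X)).
by rewrite has_count; have := graft_special X; rewrite /= hX => ->.
Qed.

Lemma necklace_front p (x y : FT) : val y = front p (val x) -> y \in necklace x.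
Proof.
move=> e; apply/mem_necklace; have [k ek] := rots_rot (find p (val x)) (val x).
by exists k; rewrite e -ek.
Qed.

(** The special tree being unique, bringing it to the front and cutting its edge recovers exactly
    one pair from the necklace. *)
Lemma card_havespecial : #|necklace @: havespecial m n.+1| = #|pair_ge|.
Proof.
have -> : necklace @: havespecial m n.+1 = (necklace \o graft) @: pair_ge.
  apply/setP => c; apply/imsetP/imsetP => [[x hx ->]|[X hX ->]].
    rewrite inE in hx; have [X e pX] := graft_front (fun _ => id) hx.
    exists X; first by rewrite -graft_special.
    by rewrite /= (necklace_eq (necklace_front e)).
  by exists (graft X); rewrite // inE val_graft /= graft_special hX.
apply: card_in_imset => X Y hX hY /= e; apply: necklace_graft => //.
by rewrite -e necklace_refl.
Qed.

Lemma pair_eq_ge : {subset pair_eq <= pair_ge}.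
Proof. by move=> X; rewrite !inE => /eqP->. Qed.

Lemma flip_pair_eq : {in pair_eq, forall X, flip_pair X \in pair_eq}.
Proof. by move=> X; rewrite !inE take_flip drop_flip eq_sym. Qed.

Lemma val_tie_graft X : X \in pair_eq -> val (tieT (graft X)) = val (graft (flip_pair X)).
Proof.
move=> hX; rewrite [LHS]/= /node_split (@tie_swap m) ?graft_half //; last exact: (valP (graft X)).
by rewrite val_graft take_flip drop_flip.
Qed.

Lemma cls_graft X : X \in pair_eq ->
  cls (graft X) = necklace (graft X) :|: necklace (graft (flip_pair X)).
Proof.
move=> hX; have e : centralT (graft X) = graft X.
  apply: val_inj; apply: central_id; apply: has_half_nobig (valP (graft X)) _.
  by rewrite val_graft /= graft_half hX.
rewrite /cls e; congr (_ :|: necklace _).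
by apply: val_inj; apply: val_tie_graft.
Qed.

(** The class of a forest with a halving edge consists of the necklaces seen from both sides of that
    edge, so [flip_pair] is the only ambiguity in the pair. *)
Lemma card_havehalf :
  2 * #|@cls m n.+1 @: havehalf m n.+1| = #|pair_eq| + #|[set X : PT | flip_pair X == X]|.
Proof.
have -> : @cls m n.+1 @: havehalf m n.+1 = (@cls m n.+1 \o graft) @: pair_eq.
  apply/setP => c; apply/imsetP/imsetP => [[x hx ->]|[X hX ->]].
    rewrite inE in hx; have [X e pX] := graft_front (@half_special n.+1) hx.
    exists X; first by rewrite -graft_half.
    by apply/cls_req; rewrite e; apply: req_front.
  by exists (graft X); rewrite // inE val_graft /= graft_half hX.
rewrite (involution_classes flip_pair_eq).
  congr (_ + _); apply: eq_card => X; rewrite !inE; apply: andb_idl => /eqP e.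
  by rewrite -{1}e drop_flip.
move=> X Y hX hY /=; have hX' := flip_pair_eq hX; have hY' := flip_pair_eq hY.
rewrite !cls_graft //; split=> [e|[->|->]] //; last by rewrite flip_pairK setUC.
have : graft Y \in necklace (graft X) :|: necklace (graft (flip_pair X)).
  by rewrite e inE necklace_refl.
by rewrite inE => /orP[] h; [left|right]; apply: necklace_graft h; apply: pair_eq_ge.
Qed.

Definition nclasses := #|@cls m n.+1 @: setT|.

Lemma card_classes :
  2 * nclasses + nforests a n (a + a) =
  2 * #|necklace @: [set: FT]| + if ~~ odd n then nforests a n./2 a else 0.
Proof.
rewrite /nclasses card_cls card_necklace card_havespecial -card_forest.
have := card_pair_ge; have := card_havehalf.
have -> : #|[set X : PT | flip_pair X == X]| = if ~~ odd n then nforests a n./2 a else 0.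
  (* Exchanging the members is the rotation by a of a + a trees; a fixed pair repeats one forest of
     a trees with n / 2 nodes. *)
  have := @fix_count a n (a + a) a isT; cbv zeta.
  have g : gcdn a (a + a) = a by rewrite gcdnDr gcdnn.
  have d : (a + a) %/ a = 2 by rewrite addnn -muln2 mulKn.
  rewrite g d dvdn2 divn2 => <-; apply: eq_card => X; by rewrite !inE -val_eqE.
lia.
Qed.
End Pairs.

(** * The formula *)

Lemma sum_coprime_gcd g d : 0 < g -> \sum_(0 <= k < d * g) (gcdn k (d * g) == g) = totient d.
Proof.
move=> g0; rewrite totient_count_coprime big_nat_mul; apply: eq_bigr => i _.
(* Among g consecutive integers only the multiple of g can have gcd g with d * g. *)
rewrite big_ltn ?ltn_pmul2r // big_nat_cond big1 ?addn0 => [|j /andP[/andP[l1 l2] _]].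
  by rewrite -muln_gcdl -[X in _ == X]mul1n eqn_pmul2r // /coprime [gcdn d i]gcdnC [LHS]addn0.
case: (gcdn j (d * g) =P g) => // e.
have /dvdnP[q ej] : g %| j by rewrite -{1}e dvdn_gcdl.
by move: l1 l2; rewrite ej !ltn_pmul2r // => l1; rewrite ltnS leqNgt l1.
Qed.

Lemma sum_gcd n (f : nat -> nat) : 0 < n ->
  \sum_(0 <= k < n) f (gcdn k n) = \sum_(d <- divisors n) totient d * f (n %/ d).
Proof.
move=> n0; transitivity (\sum_(0 <= k < n) \sum_(d <- divisors n) (gcdn k n == n %/ d) * f (n %/ d)).
  apply: eq_bigr => k _; have gn := dvdn_gcdr k n.
  have g0 : 0 < gcdn k n by rewrite gcdn_gt0 n0 orbT.
  have dn : n %/ gcdn k n \in divisors n by rewrite -dvdn_divisors // dvdn_div.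
  rewrite (bigD1_seq _ dn (divisors_uniq n)) /= divnA // mulKn // eqxx mul1n.
  rewrite big_seq_cond big1 ?addn0 // => d /andP[]; rewrite -dvdn_divisors // => dvd ne.
  case: (gcdn k n =P n %/ d) => [e|_]; last by rewrite mul0n.
  by move: ne; rewrite e divnA // mulKn // eqxx.
rewrite exchange_big; apply: eq_big_seq => d; rewrite -dvdn_divisors // => dn.
rewrite -big_distrl /=; congr (_ * _).
have d0 : 0 < n %/ d by rewrite divn_gt0 ?(dvdn_gt0 n0 dn) // dvdn_leq.
by rewrite -(@sum_coprime_gcd (n %/ d)) // mulnC divnK.
Qed.

Lemma nforests_diag a s M : 0 < a -> s.+1 * nforests a s.+1 M.+1 = M.+1 * 'C(M + a * s.+1, s).
Proof.
move=> a0; have := nforestsE s.+1 M.+1 a0; rewrite addSn => e.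
apply/eqP; rewrite -(@eqn_pmul2l (M + a * s.+1).+1) // mulnCA e mulnCA.
by rewrite -mul_bin_diag mulnCA.
Qed.

(** The identity t C(M, t) = M C(M - 1, t - 1) turns the sum into a Vandermonde convolution. *)
Lemma sum_bin_forests a s M : 0 < a -> 0 < s -> 0 < M ->
  \sum_(1 <= t < (minn M s).+1) t * 'C(M, t) * 'C(a * s, s - t) = s * nforests a s M.
Proof.
move=> a0; case: s M => // s [//|M] _ _; rewrite nforests_diag //.
rewrite big_add1 /= [in X in minn X]/=.
(* The terms added beyond the minimum vanish, because their first binomial does. *)
transitivity (\sum_(0 <= t < s.+1) t.+1 * 'C(M.+1, t.+1) * 'C(a * s.+1, s - t)).
  rewrite [RHS](@big_cat_nat _ _ _ (minn M.+1 s.+1)) ?geq_minr //=.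
  rewrite [X in _ = _ + X]big_nat_cond [X in _ = _ + X]big1 ?addn0 => [|t].
    by apply: eq_big_nat => t _; rewrite subSS.
  rewrite andbT geq_min => /andP[/orP[lt|lt] lt']; last by lia.
  by rewrite bin_small ?muln0 // ltnS.
rewrite -binomial.Vandermonde big_distrr big_mkord /=.
apply: eq_bigr => t _; rewrite -mul_bin_diag mulnA //.
Qed.

Lemma nforests_double a n : 0 < a -> n.+2 * nforests a n (a + a) = 2 * 'C(a * n.+2, n).
Proof.
move=> a0; have := nforestsE n (a + a) a0.
have -> : a + a + a * n = a * n.+2 by lia.
rewrite addnn -muln2 -!mulnA => /eqP; rewrite eqn_pmul2l // => /eqP ->; lia.
Qed.

Lemma nforests_half a h : 0 < a -> h.+1 * nforests a h a = 'C(a * h.+1, h).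
Proof.
move=> a0; have := nforestsE h a a0; rewrite -mulnS -mulnA => /eqP.
by rewrite eqn_pmul2l // => /eqP.
Qed.

(* Imported only here because classical sets shadow the names of finite sets. *)
From mathcomp Require Import boolp classical_sets functions cardinality.

(** * Isomorphism classes of the mutation class, and the final count *)

Section Isomorphic.
Variables (m : nat) (V : finType).
Implicit Types Q : cquiver m V.

Lemma isomorphic_refl Q : isomorphic Q Q.
Proof. by exists id => //; exists id. Qed.

Lemma isomorphic_sym Q Q' : isomorphic Q Q' -> isomorphic Q' Q.
Proof.
case=> f [g fK gK] h; exists g; first by exists f.
by move=> i j c; rewrite -h !gK.
Qed.

Lemma isomorphic_trans Q Q' Q'' : isomorphic Q Q' -> isomorphic Q' Q'' -> isomorphic Q Q''.
Proof.
case=> f fb h [g gb h']; exists (g \o f); first exact: bij_comp.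
by move=> i j c; rewrite /= h' h.
Qed.

Lemma iso_class_eq Q Q' : iso_class Q = iso_class Q' <-> isomorphic Q Q'.
Proof.
split=> [e|h]; last first.
  apply/seteqP; split=> Q'' /=; first exact/isomorphic_trans/isomorphic_sym.
  exact: isomorphic_trans.
by have : iso_class Q Q' by rewrite e; apply: isomorphic_refl.
Qed.
End Isomorphic.

Lemma iso_classes_card (n m : nat) (D : rel 'I_n.+1) (hD : dynkinA D) : 0 < m ->
  ([set iso_class Q | Q in mutation_class (dynkinA_cquiver m hD)]%classic
     #= `I_(nclasses m n)%classic)%card.
Proof.
move=> m0; set Q0 := dynkinA_cquiver m hD; rewrite /nclasses; set C := @cls m n.+1 @: _.
have r0 : exists F, rep Q0 F by eexists; apply: rep_dynkinA.
have repU (Q : cquiver m 'I_n.+1) F : rep Q F -> unlabel F \in forests m.+1 n.+1 m.+2.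
  move=> r; have [sF wF _ _ _] := r; rewrite mem_forests size_unlabel sF wf_map wF nodes_map.
  by rewrite (rep_nodes r) card_ord !eqxx.
(* Every shape is realized; [psi] chooses a quiver of the mutation class for each. *)
have /choice[psi psiP] (x : forest m.+1 n.+1 m.+2) :
    exists Q, mutation_class Q0 Q /\ exists2 F, rep Q F & unlabel F = val x.
  have [sx wx nx] := forestP x.
  have [|Q [F [cQ rF eF]]] := all_realized m0 r0 sx wx; first by rewrite nx card_ord.
  by exists Q; split=> //; exists F.
have [F0 rF0] := r0; pose x0 : forest m.+1 n.+1 m.+2 := SeqSub (repU _ _ rF0).
pose r (i : nat) := odflt x0 [pick x | cls x == nth finset.set0 (enum C) i].
have rP i : i < #|C| -> cls (r i) = nth finset.set0 (enum C) i.
  move=> lt; rewrite /r; case: pickP => [x /eqP//|].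
  have : nth finset.set0 (enum C) i \in C by rewrite -mem_enum mem_nth // -cardE.
  by case/imsetP=> x _ -> /(_ x); rewrite eqxx.
have iso_req (Q Q' : cquiver m 'I_n.+1) F F' : rep Q F -> rep Q' F' ->
    isomorphic Q Q' <-> req m.+1 (unlabel F) (unlabel F').
  by move=> rF rF'; split; [exact: (iso_shape ord0 rF rF')|exact: (iso_rep ord0 rF rF')].
pose h i := iso_class (psi (r i)).
have -> : [set iso_class Q | Q in mutation_class Q0]%classic = (h @` `I_#|C|)%classic.
  apply/seteqP; split=> c /= [].
    move=> Q cQ <-; have [F rF] := class_rep m0 r0 cQ.
    pose x : forest m.+1 n.+1 m.+2 := SeqSub (repU _ _ rF).
    have xC : cls x \in enum C by rewrite mem_enum imset_f.
    exists (index (cls x) (enum C)); first by rewrite /= cardE index_mem.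
    have lt : index (cls x) (enum C) < #|C| by rewrite cardE index_mem.
    apply/iso_class_eq; have [_ [G rG eG]] := psiP (r (index (cls x) (enum C))).
    apply/(iso_req _ _ _ _ rG rF); rewrite eG; apply/(cls_req _ x).
    by rewrite rP // nth_index.
  by move=> i _ <-; exists (psi (r i)) => //; case: (psiP (r i)).
apply: inj_card_eq => i j; rewrite !inE /= => li lj /iso_class_eq.
have [_ [F rF eF]] := psiP (r i); have [_ [G rG eG]] := psiP (r j).
move/(iso_req _ _ _ _ rF rG); rewrite eF eG => /cls_req.
rewrite !rP // => /eqP; rewrite nth_uniq ?enum_uniq -?cardE // => /eqP.
exact.
Qed.

Import GRing.Theory Num.Theory.
Local Open Scope ring_scope.

(** Burnside's sum runs over the divisors d of m + 2, and only those that also divide n contribute;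
    [sum_bin_forests] then produces the inner sum over t. *)
Lemma necklace_formula (n m : nat) : (0 < n)%N ->
  (#|necklace @: [set: forest m.+1 n m.+2]|%:R : rat) =
  \sum_(d <- divisors n | (d %| m + 2)%N)
        \sum_(1 <= t < (minn ((m + 2) %/ d) (n %/ d)).+1)
          ((totient d)%:R * d%:R * t%:R / ((m + 2)%:R * n%:R)
           * 'C((m + 2) %/ d, t)%:R
           * 'C((m + 1) * (n %/ d), n %/ d - t)%:R).
Proof.
move=> n0; have M0 : (m + 2)%:R != 0 :> rat by rewrite pnatr_eq0 addn2.
apply: (mulIf M0); rewrite [in LHS]addn2 -[LHS]natrM necklace_count.
rewrite (sum_gcd (fun g => if (m.+2 %/ g %| n)%N then nforests m.+1 (n %/ (m.+2 %/ g)) g else 0%N)) //.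
rewrite big_distrl /=.
transitivity (\sum_(d <- divisors n | (d %| m + 2)%N)
  (totient d * nforests m.+1 (n %/ d) (m.+2 %/ d))%:R : rat).
  rewrite -natr_sum; congr (_%:R); rewrite -[RHS]big_filter.
  have -> : \sum_(d <- divisors m.+2) (totient d * (if (m.+2 %/ (m.+2 %/ d) %| n)%N then
      nforests m.+1 (n %/ (m.+2 %/ (m.+2 %/ d))) (m.+2 %/ d) else 0))%N =
      \sum_(d <- [seq d <- divisors m.+2 | (d %| n)%N]) (totient d * nforests m.+1 (n %/ d) (m.+2 %/ d))%N.
    rewrite big_filter [RHS]big_mkcond; apply: eq_big_seq => d; rewrite -dvdn_divisors // => dM.
    by rewrite divnA // mulKn //; case: ifP => _; rewrite ?muln0.
  apply: perm_big; apply: uniq_perm; rewrite ?filter_uniq ?divisors_uniq // => d.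
  by rewrite !mem_filter -!dvdn_divisors // addn2 andbC.
rewrite big_seq_cond [RHS]big_seq_cond; apply: eq_bigr => d /andP[].
rewrite -dvdn_divisors // addn2 => dn dM.
have d0 : (0 < d)%N := dvdn_gt0 n0 dn.
have s0 : (0 < n %/ d)%N by rewrite divn_gt0 // dvdn_leq.
have K0 : (0 < m.+2 %/ d)%N by rewrite divn_gt0 // dvdn_leq.
rewrite (eq_bigr (fun t => ((totient d)%:R * d%:R / (m.+2%:R * n%:R)) *
   (t * 'C(m.+2 %/ d, t) * 'C(m.+1 * (n %/ d), n %/ d - t))%:R)); last first.
  by move=> t _; rewrite addn1 !natrM; ring.
rewrite -big_distrr /= -natr_sum sum_bin_forests // !natrM.
have en : n%:R = d%:R * (n %/ d)%:R :> rat by rewrite -natrM mulnC divnK.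
have s0' : (n %/ d)%:R != 0 :> rat by rewrite pnatr_eq0 -lt0n.
have d0' : d%:R != 0 :> rat by rewrite pnatr_eq0 -lt0n.
have K0' : m.+2%:R != 0 :> rat by rewrite pnatr_eq0.
rewrite en; move: (nforests _ _ _)%:R (totient d)%:R => u v; move: s0' d0' K0'.
move: (n %/ d)%:R d%:R m.+2%:R => x y z x0 y0 z0; field.
by rewrite x0 y0 z0.
Qed.

Lemma class_count (n m : nat) :
  ((nclasses m n)%:R : rat) = #|necklace @: [set: forest m.+1 n.+1 m.+2]|%:R
      - 1 / n.+2%:R * 'C((m + 1) * n.+2, n.+1 - 1)%:R
      + (if (2 %| n.+2)%N
         then 1 / n.+2%:R * 'C((m + 1) * n.+2 %/ 2, n.+2 %/ 2 - 1)%:R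
         else 0).
Proof.
have e : 2%:R * (nclasses m n)%:R + (nforests m.+1 n (m.+1 + m.+1))%:R =
    2%:R * #|necklace @: [set: forest m.+1 n.+1 m.+2]|%:R
    + (if ~~ odd n then nforests m.+1 n./2 m.+1 else 0%N)%:R :> rat.
  have cast (x p y d : nat) : (2 * x + p = 2 * y + d)%N ->
      2%:R * x%:R + p%:R = 2%:R * y%:R + d%:R :> rat by rewrite -!natrM -!natrD => ->.
  exact: (cast _ _ _ _ (card_classes m n)).
have nz k : k.+1%:R != 0 :> rat by rewrite pnatr_eq0.
have p2 : 2%:R != 0 :> rat by [].
have eP : (nforests m.+1 n (m.+1 + m.+1))%:R = 2%:R * ('C((m + 1) * n.+2, n.+1 - 1)%:R / n.+2%:R) :> rat.
  apply: (mulfI (nz n.+1)); rewrite -natrM nforests_double // addn1 subn1 natrM.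
  by rewrite [RHS]mulrCA [_ * (_ / _)]mulrC mulfVK.
have eD : (if ~~ odd n then nforests m.+1 n./2 m.+1 else 0%N)%:R =
   2%:R * (if (2 %| n.+2)%N
         then 1 / n.+2%:R * 'C((m + 1) * n.+2 %/ 2, n.+2 %/ 2 - 1)%:R
         else 0) :> rat.
  (* Here n counts the diagonals other than the halving one, and n + 2 has the same parity. *)
  rewrite dvdn2 /= negbK; case: (boolP (odd n)) => on /=; first by rewrite mulr0.
  have en : n = (n./2 * 2)%N by rewrite muln2 -[LHS]odd_double_half (negbTE on).
  set h := n./2 in en *; have -> : n.+2 = (h.+1 * 2)%N by rewrite en mulSn.
  rewrite mulnA !mulnK // subn1 /= addn1 -(nforests_half h) // !natrM.
  by field; rewrite nat1r.
have mul2I (x y : rat) : 2%:R * x = 2%:R * y -> x = y := @mulfI _ _ p2 x y.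
apply: mul2I; rewrite mulrDr mulrBr -eD -[LHS](addrK (nforests m.+1 n (m.+1 + m.+1))%:R) e.
by rewrite eP div1r [n.+2%:R^-1 * _]mulrC addrAC.
Qed.

Theorem theorem5p2 (n m : nat) (hn : (0 < n)%N) (hm : (0 < m)%N)
    (D : rel 'I_n) (hD : dynkinA D) :
  exists N : nat,
    ([set iso_class Q | Q in mutation_class (dynkinA_cquiver m hD)]%classic
       #= `I_N%classic)%card
    /\
    N%:R =
      \sum_(d <- divisors n | (d %| m + 2)%N)
        \sum_(1 <= t < (minn ((m + 2) %/ d) (n %/ d)).+1)
          ((totient d)%:R * d%:R * t%:R / ((m + 2)%:R * n%:R)
           * 'C((m + 2) %/ d, t)%:R
           * 'C((m + 1) * (n %/ d), n %/ d - t)%:R)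
      - 1 / n.+1%:R * 'C((m + 1) * n.+1, n - 1)%:R
      + (if (2 %| n.+1)%N
         then 1 / n.+1%:R * 'C((m + 1) * n.+1 %/ 2, n.+1 %/ 2 - 1)%:R
         else 0) :> rat.
Proof.
case: n hn D hD => // n _ D hD; exists (nclasses m n).
split; first exact: iso_classes_card.
by rewrite class_count necklace_formula.
Qed.
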